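(* Let $m,n,r$ be positive integers with $r<\min\{m,n\}$, let $f:\mathbb{R}^{m\times n}\to\mathbb{R}$ be differentiable with locally Lipschitz continuous gradient, and let $0<\underline{\alpha}\le\overline{\alpha}<\infty$, $\beta,c\in(0,1)$, $\Delta\in(0,\infty)$. Consider a sequence generated by $\mathrm{P}^2\mathrm{GD}$--$\mathrm{PGD}$ (with these parameters, from any starting point $X_0\in\mathbb{R}^{m\times n}_{\le r}$) for the problem $\min_{X\in\mathbb{R}^{m\times n}_{\le r}}f(X)$. If this sequence is finite, then its last element is B-stationary. If it is infinite, then all of its accumulation points are B-stationary.
   Context: $\mathbb{R}^{m\times n}$ carries the Frobenius inner product $\langle X,Y\rangle=\operatorname{tr}(Y^\top X)$ and the induced norm $\|\cdot\|$. $\mathbb{R}^{m\times n}_{\le r}=\{X\in\mathbb{R}^{m\times n}\mid \operatorname{rank}X\le r\}$. For a nonempty set $S$ and a point $x$, $P_S(x)=\operatorname{argmin}_{y\in S}\|x-y\|$ (a set). For $X\in S$, the tangent cone $T_S(X)$ is the set of all $V$ for which there exist sequences $(X_i)$ in $S$ converging to $X$ and $(t_i)$ in $(0,\infty)$ with $(X_i-X)/t_i\to V$; the regular normal cone is its polar, $\widehat N_S(X)=\{W\mid\langle V,W\rangle\le 0\ \forall V\in T_S(X)\}$. A point $X\in\mathbb{R}^{m\times n}_{\le r}$ is B-stationary if $-\nabla f(X)\in\widehat N_{\mathbb{R}^{m\times n}_{\le r}}(X)$. All elements of $P_{T_{\mathbb{R}^{m\times n}_{\le r}}(X)}(-\nabla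 f(X))$ have the same norm, denoted $\mathrm{s}(X;f,\mathbb{R}^{m\times n}_{\le r})$. For $\Delta>0$, $\operatorname{rank}_\Delta X$ is the number of singular values of $X$ that are greater than $\Delta$. $\mathrm{P}^2\mathrm{GD}$ map: for $X\in\mathbb{R}^{m\times n}_{\le r}$, $\mathrm{P}^2\mathrm{GD}(X)$ is the set of all possible outputs $Y$ of the following procedure. Choose $G\in P_{T_{\mathbb{R}^{m\times n}_{\le r}}(X)}(-\nabla f(X))$, $\alpha\in[\underline{\alpha},\overline{\alpha}]$ and $Y\in P_{\mathbb{R}^{m\times n}_{\le r}}(X+\alpha G)$; while $f(Y)>f(X)-c\,\alpha\,\mathrm{s}(X;f,\mathbb{R}^{m\times n}_{\le r})^2$, replace $\alpha$ by $\alpha\beta$ and choose $Y\in P_{\mathbb{R}^{m\times n}_{\le r}}(X+\alpha G)$; return $Y$. Monotone $\mathrm{PGD}$ map: for $X\in\mathbb{R}^{m\times n}_{\le r}$, $\mathrm{PGD}(X)$ is the set of all possible outputs $Y$ of the following procedure. Choose $\alpha\in[\underline{\alpha},\overline{\alpha}]$ and $Y\in P_{\mathbb{R}^{m\times n}_{\le r}}(X-\alpha\nabla f(X))$; while $f(Y)>f(X)+c\,\langle\nabla f(X),Y-X\rangle$, replace $\alpha$ by $\alpha\beta$ and choose $Y\in P_{\mathbb{R}^{m\times n}_{\le r}}(X-\alpha\nabla f(X))$; return $Y$. $\mathrm{P}^2\mathrm{GD}$--$\mathrm{PGD}$ map: it associates with $X\in\mathbb{R}^{m\times n}_{\le r}$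 the set $\mathrm{P}^2\mathrm{GD}(X)$ if $\operatorname{rank}X=\operatorname{rank}_\Delta X$, and the set $\mathrm{PGD}(X)$ otherwise. A sequence generated by $\mathrm{P}^2\mathrm{GD}$--$\mathrm{PGD}$ starts at some $X_0\in\mathbb{R}^{m\times n}_{\le r}$; as long as $X_i$ is not B-stationary, some $X_{i+1}$ in the image of $X_i$ under the $\mathrm{P}^2\mathrm{GD}$--$\mathrm{PGD}$ map is chosen; the sequence stops at $X_i$ if $X_i$ is B-stationary. *)

(* Defs.v *)
From HB Require Import structures.
From mathcomp Require Import all_boot all_order all_algebra.
From mathcomp Require Import polyrcf ring lra.
From mathcomp Require Import boolp classical_sets reals topology normedtype.
From mathcomp Require Import sequences derive.

Set Implicit Arguments.
Unset Strict Implicit.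
Unset Printing Implicit Defensive.
Import Order.TTheory GRing.Theory Num.Theory.
Import numFieldNormedType.Exports.
Local Open Scope classical_set_scope.
Local Open Scope ring_scope.

(* The library norm `|X| on matrices is the max norm, so the Frobenius
   structure is defined here.  The library topology on 'M[R]_(m, n) is the
   entrywise one, which is the topology of the Frobenius norm. *)
Definition frob (R : realType) (m n : nat) (X Y : 'M[R]_(m, n)) : R :=
  \tr (Y^T *m X).

Definition frobnorm (R : realType) (m n : nat) (X : 'M[R]_(m, n)) : R :=
  Num.sqrt (frob X X).

Definition rank_le (R : realType) (m n r : nat) : set 'M[R]_(m, n) :=
  [set X | (\rank X <= r)%N].

Definition proj (R : realType) (m n : nat) (S : set 'M[R]_(m, n))
    (X : 'M[R]_(m, n)) : set 'M[R]_(m, n) :=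
  [set Y | S Y /\ forall Z, S Z -> frobnorm (X - Y) <= frobnorm (X - Z)].

Definition tangent_cone (R : realType) (m n : nat) (S : set 'M[R]_(m, n))
    (X : 'M[R]_(m, n)) : set 'M[R]_(m, n) :=
  [set V | exists (Xs : nat -> 'M[R]_(m, n)) (t : nat -> R),
    [/\ forall i, S (Xs i),
        Xs i @[i --> \oo] --> X,
        forall i, 0 < t i
      & (t i)^-1 *: (Xs i - X) @[i --> \oo] --> V]].

Definition regular_normal_cone (R : realType) (m n : nat)
    (S : set 'M[R]_(m, n)) (X : 'M[R]_(m, n)) : set 'M[R]_(m, n) :=
  [set W | forall V, tangent_cone S X V -> frob V W <= 0].

(* The Frobenius gradient: the Riesz representative of 'd f X when f is
   differentiable at X, see [gradP]. *)
Definition grad (R : realType) (m n : nat) (f : 'M[R]_(m, n) -> R)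
    (X : 'M[R]_(m, n)) : 'M[R]_(m, n) :=
  \matrix_(i, j) 'd f X (delta_mx i j).

Definition locally_lipschitz (R : realType) (m n : nat)
    (g : 'M[R]_(m, n) -> 'M[R]_(m, n)) : Prop :=
  forall X : 'M[R]_(m, n), exists (U : set 'M[R]_(m, n)) (L : R), nbhs X U /\
    forall Y Z, U Y -> U Z -> frobnorm (g Y - g Z) <= L * frobnorm (Y - Z).

Definition B_stationary (R : realType) (m n r : nat)
    (f : 'M[R]_(m, n) -> R) (X : 'M[R]_(m, n)) : Prop :=
  rank_le r X /\ regular_normal_cone (@rank_le R m n r) X (- grad f X).

(* The common norm of all projections of - grad f X onto the tangent cone:
   [xget] picks one of them, and by [proj_cone_norm] the choice is
   irrelevant. *)
Definition stat_measure (R : realType) (m n r : nat)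
    (f : 'M[R]_(m, n) -> R) (X : 'M[R]_(m, n)) : R :=
  frobnorm (xget 0 (proj (tangent_cone (@rank_le R m n r) X) (- grad f X))).

(* Square roots of the eigenvalues of X^T X, repeated according to their
   multiplicity as roots of its characteristic polynomial.  There are n of
   them rather than minn m n: if m < n the list has n - m additional zeros,
   which do not count in [rank_Delta] for Delta > 0. *)
Definition singular_values (R : realType) (m n : nat) (X : 'M[R]_(m, n)) :
    seq R :=
  let p := char_poly (X^T *m X) in
  flatten [seq nseq (mup l p) (Num.sqrt l) | l <- rootsR p].

Definition rank_Delta (R : realType) (m n : nat) (Delta : R)
    (X : 'M[R]_(m, n)) : nat :=
  count (fun s => Delta < s) (singular_values X).

(* [backtracking beta cand reject a Y]: Y is a possible output of the loop
   "choose Y in cand a; while reject a Y, replace a by a * beta and choose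
   Y in cand a; return Y". *)
Inductive backtracking (R : realType) (T : Type) (beta : R)
    (cand : R -> set T) (reject : R -> T -> Prop) : R -> T -> Prop :=
| backtracking_stop (a : R) (Y : T) :
    cand a Y -> ~ reject a Y -> backtracking beta cand reject a Y
| backtracking_step (a : R) (Y Z : T) :
    cand a Y -> reject a Y ->
    backtracking beta cand reject (a * beta) Z ->
    backtracking beta cand reject a Z.

(* In the maps below, amin and amax are the bounds on the initial step size. *)
Definition P2GD (R : realType) (m n r : nat) (f : 'M[R]_(m, n) -> R)
    (amin amax beta c : R) (X : 'M[R]_(m, n)) : set 'M[R]_(m, n) :=
  [set Y | exists (G : 'M[R]_(m, n)) (a : R),
    [/\ proj (tangent_cone (@rank_le R m n r) X) (- grad f X) G,
        amin <= a <= amax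
      & backtracking beta
          (fun a' => proj (@rank_le R m n r) (X + a' *: G))
          (fun a' Y' => f Y' > f X - c * a' * stat_measure r f X ^+ 2)
          a Y]].

Definition PGD (R : realType) (m n r : nat) (f : 'M[R]_(m, n) -> R)
    (amin amax beta c : R) (X : 'M[R]_(m, n)) : set 'M[R]_(m, n) :=
  [set Y | exists a : R,
    amin <= a <= amax /\
    backtracking beta
      (fun a' => proj (@rank_le R m n r) (X - a' *: grad f X))
      (fun _ Y' => f Y' > f X + c * frob (grad f X) (Y' - X))
      a Y].

Definition P2GD_PGD (R : realType) (m n r : nat) (f : 'M[R]_(m, n) -> R)
    (amin amax beta c Delta : R) (X : 'M[R]_(m, n)) : set 'M[R]_(m, n) :=
  if \rank X == rank_Delta Delta X then P2GD r f amin amax beta c X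
  else PGD r f amin amax beta c X.

Definition P2GD_PGD_step (R : realType) (m n r : nat)
    (f : 'M[R]_(m, n) -> R) (amin amax beta c Delta : R)
    (Xs : nat -> 'M[R]_(m, n)) (i : nat) : Prop :=
  ~ B_stationary r f (Xs i) /\
  P2GD_PGD r f amin amax beta c Delta (Xs i) (Xs i.+1).

(* The finite sequence Xs 0, ..., Xs N is generated by the algorithm (values
   beyond N are irrelevant).  It ends because Xs N is B-stationary or because
   the map has no output at Xs N; keeping the second possibility makes the
   B-stationarity of the last element a genuine claim, namely that the
   algorithm never breaks down. *)
Definition generated_finite (R : realType) (m n r : nat)
    (f : 'M[R]_(m, n) -> R) (amin amax beta c Delta : R)
    (Xs : nat -> 'M[R]_(m, n)) (N : nat) : Prop :=
  [/\ rank_le r (Xs 0),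
      forall i, (i < N)%N -> P2GD_PGD_step r f amin amax beta c Delta Xs i
    & B_stationary r f (Xs N) \/
      P2GD_PGD r f amin amax beta c Delta (Xs N) = set0].

Definition generated_infinite (R : realType) (m n r : nat)
    (f : 'M[R]_(m, n) -> R) (amin amax beta c Delta : R)
    (Xs : nat -> 'M[R]_(m, n)) : Prop :=
  rank_le r (Xs 0) /\
  forall i, P2GD_PGD_step r f amin amax beta c Delta Xs i.

Section Facts.
Variables (R : realType) (m n : nat).
Implicit Types (X Y Z V : 'M[R]_(m, n)) (a : R).

Lemma frobE X Y : frob X Y = \sum_i \sum_j X i j * Y i j.
Proof.
rewrite /frob /mxtrace exchange_big/=; apply: eq_bigr => j _.
by rewrite mxE; apply: eq_bigr => i _; rewrite mxE mulrC.
Qed.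

Lemma frobC X Y : frob X Y = frob Y X.
Proof.
by rewrite !frobE; do 2![apply: eq_bigr => ? _]; rewrite mulrC.
Qed.

Lemma frobDl X Y Z : frob (X + Y) Z = frob X Z + frob Y Z.
Proof. by rewrite /frob mulmxDr mxtraceD. Qed.

Lemma frobZl a X Y : frob (a *: X) Y = a * frob X Y.
Proof. by rewrite /frob -scalemxAr mxtraceZ. Qed.

Lemma frobDr X Y Z : frob Z (X + Y) = frob Z X + frob Z Y.
Proof. by rewrite !(frobC Z) frobDl. Qed.

Lemma frobZr a X Y : frob X (a *: Y) = a * frob X Y.
Proof. by rewrite !(frobC X) frobZl. Qed.

Lemma frob_ge0 X : 0 <= frob X X.
Proof. by rewrite frobE; do 2![apply: sumr_ge0 => ? _]; rewrite -expr2 sqr_ge0. Qed.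

Lemma frobnorm_sqr X : frobnorm X ^+ 2 = frob X X.
Proof. by rewrite sqr_sqrtr ?frob_ge0. Qed.

Lemma frob_subsqr X Y :
  frob (X - Y) (X - Y) = frob X X - 2 * frob X Y + frob Y Y.
Proof.
rewrite -scaleN1r frobDl !frobDr !frobZl !frobZr (frobC Y X).
by ring.
Qed.

Lemma gradP (f : 'M[R]_(m, n) -> R) X V :
  'd f X V = frob (grad f X) V.
Proof.
rewrite frobE {1}[V]matrix_sum_delta raddf_sum/=.
apply: eq_bigr => i _; rewrite raddf_sum/=; apply: eq_bigr => j _.
by rewrite linearZ/= mxE mulrC.
Qed.

Lemma tangent_coneZ (S : set 'M[R]_(m, n)) X a V :
  0 < a -> tangent_cone S X V -> tangent_cone S X (a *: V).
Proof.
move=> a0 [Xs [t [SXs cXs t0 cV]]]; exists Xs, (fun i => t i / a).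
split=> // [i|]; first by rewrite divr_gt0.
rewrite (_ : (fun i => _) = (fun i => a *: ((t i)^-1 *: (Xs i - X)))).
  exact: (cvgZ (cvg_cst a) cV).
by apply/funext => i; rewrite scalerA invf_div.
Qed.

(* If G is a projection of Z onto a cone then <Z - G, G> = 0, so that
   ||G||^2 = ||Z||^2 - ||Z - G||^2 depends only on Z and the cone. *)
Lemma proj_cone_norm (K : set 'M[R]_(m, n)) Z X Y :
  (forall a V, 0 < a -> K V -> K (a *: V)) ->
  proj K Z X -> proj K Z Y -> frobnorm X = frobnorm Y.
Proof.
move=> Kcone; have key W : proj K Z W -> frob W W = frob Z W.
  move=> [KW minW]; set p := frob W W; set q := frob Z W.
  have p0 : 0 <= p by exact: frob_ge0.
  have quad a : 0 < a -> 0 <= (a - 1) * ((a + 1) * p - 2 * q).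
    move=> a0; have := minW _ (Kcone _ _ a0 KW).
    rewrite ler_sqrt ?frob_ge0// !frob_subsqr frobZr frobZl frobZr -/p -/q.
    by move=> h; lra.
  have [//|qp] := eqVneq p q.
  have [p00|pn0] := eqVneq p 0.
    have := quad 2 ltac:(lra); have := quad (1 / 2) ltac:(lra).
    by rewrite !p00 => h1 h2; lra.
  have pgt0 : 0 < p by rewrite lt_def pn0.
  have [q0|q0] := leP q 0.
    by have := quad (1 / 2) ltac:(lra); move=> h; nra.
  have qE : q = (q / p) * p by rewrite divfK.
  have t0 : 0 < q / p by rewrite divr_gt0.
  have := quad _ t0; move: qE qp; set t := q / p => qE qp.
  rewrite (_ : (t - 1) * _ = - ((t - 1) ^+ 2 * p)); last by rewrite qE; ring.
  rewrite oppr_ge0 pmulr_lle0// => h.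
  have /eqP : (t - 1) ^+ 2 = 0 by apply/le_anti; rewrite h sqr_ge0.
  by rewrite sqrf_eq0 subr_eq0 => /eqP t1; move: qp; rewrite qE t1 mul1r eqxx.
move=> pX pY; have := key _ pX; have := key _ pY; move=> qY qX.
have [[KX minX] [KY minY]] := (pX, pY).
have : frobnorm (Z - X) = frobnorm (Z - Y).
  by apply/le_anti; rewrite minX// minY.
move=> /(congr1 (fun x => x ^+ 2)); rewrite !frobnorm_sqr !frob_subsqr -qX -qY.
by move=> h; congr Num.sqrt; lra.
Qed.
End Facts.

(* Main.v *)
Require Import Defs.
From HB Require Import structures.
From mathcomp Require Import all_boot all_order all_algebra.
From mathcomp Require Import polyrcf ring lra.
From mathcomp Require Import boolp classical_sets reals topology normedtype.
From mathcomp Require Import sequences derive realfun.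

(* The P2GD-PGD map never increases f, so by continuity of f it suffices to show
   that near a point X of rank <= r that is not B-stationary the decrease is
   bounded below by a positive constant.  In both maps the accepted step size is
   bounded below near X, by the descent lemma for locally Lipschitz gradients.

   For PGD, non-stationarity gives Z' of rank <= r close to X such that
   |Z' - X|^2 / a + 2 <grad f X, Z' - X> < 0 for the smallest possible step a;
   comparing the projection with Z' then yields
   2 <grad f Y, Z - Y> <= |Z' - Y|^2 / a + 2 <grad f Y, Z' - Y> for Y near X,
   and the right-hand side stays negative by continuity.

   For P2GD, points Y near X whose nonzero singular values all exceed Delta have
   the same rank as X.  Such points are Y = A X B with A and B close to the
   identity, so the tangent cones are T(Y) = A T(X) B; hence the stationarity
   measure is bounded below near X, and the tangent cones approximate the
   variety to second order with a uniform constant.  With W a generalized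
   inverse of X, the tangent cone is {V | rank (X + (1 - X W) V) <= r}, and
   (X + (1 - X W) V) (1 + W V) = X + V + O(|V|^2) is the second order
   approximation. *)

Set Implicit Arguments.
Unset Strict Implicit.
Unset Printing Implicit Defensive.
Import Order.TTheory GRing.Theory Num.Theory.
Import numFieldNormedType.Exports.
Local Open Scope classical_set_scope.
Local Open Scope ring_scope.

(** * The Frobenius norm *)

Section FrobeniusNorm.
Variable R : realType.

Lemma frob0l m n (X : 'M[R]_(m, n)) : frob 0 X = 0.
Proof. by rewrite -(scale0r 0) frobZl mul0r. Qed.

Lemma frob0r m n (X : 'M[R]_(m, n)) : frob X 0 = 0.
Proof. by rewrite frobC frob0l. Qed.

Lemma frobNl m n (X Y : 'M[R]_(m, n)) : frob (- X) Y = - frob X Y.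
Proof. by rewrite -scaleN1r frobZl mulN1r. Qed.

Lemma frobNr m n (X Y : 'M[R]_(m, n)) : frob X (- Y) = - frob X Y.
Proof. by rewrite frobC frobNl frobC. Qed.

Lemma frobBl m n (X Y Z : 'M[R]_(m, n)) : frob (X - Y) Z = frob X Z - frob Y Z.
Proof. by rewrite frobDl frobNl. Qed.

Lemma frobnorm_ge0 m n (X : 'M[R]_(m, n)) : 0 <= frobnorm X.
Proof. exact: sqrtr_ge0. Qed.

Lemma frobnorm0 m n : frobnorm (0 : 'M[R]_(m, n)) = 0.
Proof. by rewrite /frobnorm frob0l sqrtr0. Qed.

Lemma frobnormN m n (X : 'M[R]_(m, n)) : frobnorm (- X) = frobnorm X.
Proof. by rewrite /frobnorm frobNl frobNr opprK. Qed.

Lemma frobnormBC m n (X Y : 'M[R]_(m, n)) : frobnorm (X - Y) = frobnorm (Y - X).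
Proof. by rewrite -frobnormN opprB. Qed.

Lemma frobnormZ m n (a : R) (X : 'M[R]_(m, n)) :
  frobnorm (a *: X) = `|a| * frobnorm X.
Proof.
by rewrite /frobnorm frobZl frobZr mulrA -expr2 sqrtrM ?sqr_ge0// sqrtr_sqr.
Qed.

Lemma frobnorm_eq0 m n (X : 'M[R]_(m, n)) : frobnorm X = 0 -> X = 0.
Proof.
move=> /eqP; rewrite sqrtr_eq0 frobE => h.
have h0 : \sum_i \sum_j X i j * X i j = 0.
  by apply/le_anti; rewrite h -frobE frob_ge0.
have pos i j : 0 <= X i j * X i j by rewrite -expr2 sqr_ge0.
apply/matrixP => i j; rewrite mxE; apply/eqP.
have /eqP := psumr_eq0P (fun i _ => sumr_ge0 _ (fun j _ => pos i j)) h0 (i := i) isT.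
rewrite psumr_eq0// => /allP/(_ j (mem_index_enum _))/=.
by rewrite mulf_eq0 orbb.
Qed.

Lemma frobnorm_CS m n (X Y : 'M[R]_(m, n)) :
  frob X Y <= frobnorm X * frobnorm Y.
Proof.
have [/frobnorm_eq0->|X0] := eqVneq (frobnorm X) 0.
  by rewrite frob0l frobnorm0 mul0r.
have [/frobnorm_eq0->|Y0] := eqVneq (frobnorm Y) 0.
  by rewrite frob0r frobnorm0 mulr0.
have Xp : 0 < frobnorm X by rewrite lt_def X0 frobnorm_ge0.
have Yp : 0 < frobnorm Y by rewrite lt_def Y0 frobnorm_ge0.
have := frob_ge0 ((frobnorm Y) *: X - (frobnorm X) *: Y).
rewrite frob_subsqr !frobZl !frobZr -!frobnorm_sqr => h.
have : 0 <= (2 * frobnorm X * frobnorm Y) * (frobnorm X * frobnorm Y - frob X Y).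
  by move: h; congr (_ <= _); ring.
by rewrite pmulr_rge0 ?subr_ge0// !mulr_gt0.
Qed.

Lemma frobnormD m n (X Y : 'M[R]_(m, n)) :
  frobnorm (X + Y) <= frobnorm X + frobnorm Y.
Proof.
rewrite -(@ler_pXn2r _ 2)// ?nnegrE ?addr_ge0 ?frobnorm_ge0//.
rewrite frobnorm_sqr frobDl !frobDr (frobC Y) -!frobnorm_sqr sqrrD.
by have := frobnorm_CS X Y; lra.
Qed.

Lemma frobnormB m n (X Y Z : 'M[R]_(m, n)) :
  frobnorm (X - Z) <= frobnorm (X - Y) + frobnorm (Y - Z).
Proof. by rewrite (le_trans _ (frobnormD _ _))// addrA subrK. Qed.

(** Each entry of the product is the inner product of a row of [X] and a column of [Y];
    Cauchy-Schwarz bounds its square, and these bounds are summed. *)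
Lemma frobnormM m n p (X : 'M[R]_(m, n)) (Y : 'M[R]_(n, p)) :
  frobnorm (X *m Y) <= frobnorm X * frobnorm Y.
Proof.
rewrite -(@ler_pXn2r _ 2)// ?nnegrE ?mulr_ge0 ?frobnorm_ge0//.
rewrite exprMn !frobnorm_sqr.
have -> : frob X X * frob Y Y =
    \sum_i \sum_k frob (row i X) (row i X) * frob (col k Y) (col k Y).
  rewrite !frobE big_distrl/=; apply: eq_bigr => i _; rewrite -big_distrr/=.
  rewrite exchange_big/=; congr (_ * _).
    by rewrite frobE big_ord1; apply: eq_bigr => j _; rewrite !mxE.
  apply: eq_bigr => k _; rewrite frobE; apply: eq_bigr => j _.
  by rewrite big_ord1 !mxE.
rewrite frobE; apply: ler_sum => i _; apply: ler_sum => k _.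
have -> : (X *m Y) i k = frob (row i X)^T (col k Y).
  rewrite mxE frobE; apply: eq_bigr => j _.
  by rewrite big_ord1 !mxE.
have -> : frob (row i X) (row i X) = frob (row i X)^T (row i X)^T.
  by rewrite !frobE exchange_big/=; do 2![apply: eq_bigr => ? _]; rewrite !mxE.
have := frobnorm_CS (row i X)^T (col k Y).
have := frobnorm_CS (- (row i X)^T) (col k Y).
rewrite frobNl frobnormN -!frobnorm_sqr => h1 h2.
by have := frobnorm_ge0 (row i X)^T; have := frobnorm_ge0 (col k Y); nra.
Qed.

Lemma coord_le_frobnorm m n (X : 'M[R]_(m, n)) i j : `|X i j| <= frobnorm X.
Proof.
rewrite -(@ler_pXn2r _ 2)// ?nnegrE ?frobnorm_ge0//.
rewrite frobnorm_sqr frobE (bigD1 i)//= (bigD1 j)//= -addrA.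
rewrite real_normK ?num_real// -expr2 lerDl addr_ge0//.
  by apply: sumr_ge0 => k _; rewrite -expr2 sqr_ge0.
by apply: sumr_ge0 => k _; apply: sumr_ge0 => l _; rewrite -expr2 sqr_ge0.
Qed.

(** * Convergence of matrices, entrywise and in the Frobenius norm *)

Lemma mx_cvg m n (T : Type) (F : set_system T) {FF : Filter F}
    (g : T -> 'M[R]_(m, n)) (X : 'M[R]_(m, n)) :
  (forall i j, g t i j @[t --> F] --> X i j) -> g @ F --> X.
Proof.
move=> gX; apply/cvgrPdist_lt => e e0.
have : \forall t \near F, forall ij : 'I_m * 'I_n,
    `|X ij.1 ij.2 - g t ij.1 ij.2| < e.
  by apply: filter_forall => ij; move/cvgrPdist_lt: (gX ij.1 ij.2); apply.
apply: filterS => t ht; rewrite [ltLHS]/Num.norm/= mx_normrE.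
by apply/bigmax_ltP; split=> // ij _; rewrite !mxE.
Qed.

Lemma cvg_coord m n (T : Type) (F : set_system T) {FF : Filter F}
    (g : T -> 'M[R]_(m, n)) (X : 'M[R]_(m, n)) i j :
  g @ F --> X -> g t i j @[t --> F] --> X i j.
Proof.
move=> gX; apply: (@cvg_comp _ _ _ g (fun M : 'M_(m, n) => M i j) _ _ _ gX).
exact: coord_continuous.
Qed.

Lemma cvg_mulmx m n p (T : Type) (F : set_system T) {FF : Filter F}
    (g : T -> 'M[R]_(m, n)) (h : T -> 'M[R]_(n, p))
    (X : 'M[R]_(m, n)) (Y : 'M[R]_(n, p)) :
  g @ F --> X -> h @ F --> Y -> g t *m h t @[t --> F] --> X *m Y.
Proof.
move=> gX hY; apply: mx_cvg => i k; rewrite mxE.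
under eq_cvg do rewrite mxE.
apply: cvg_big => [|j _]; first exact: add_continuous.
by apply: cvgM; exact: cvg_coord.
Qed.

Lemma cvg_frob m n (T : Type) (F : set_system T) {FF : Filter F}
    (g h : T -> 'M[R]_(m, n)) (X Y : 'M[R]_(m, n)) :
  g @ F --> X -> h @ F --> Y -> frob (g t) (h t) @[t --> F] --> frob X Y.
Proof.
move=> gX hY; rewrite frobE; under eq_cvg do rewrite frobE.
apply: cvg_big => [|i _]; first exact: add_continuous.
apply: cvg_big => [|j _]; first exact: add_continuous.
by apply: cvgM; exact: cvg_coord.
Qed.

Lemma cvg_frobnorm m n (T : Type) (F : set_system T) {FF : Filter F}
    (g : T -> 'M[R]_(m, n)) (X : 'M[R]_(m, n)) :
  g @ F --> X -> frobnorm (g t) @[t --> F] --> frobnorm X.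
Proof.
move=> gX; apply: (@cvg_comp _ _ _ _ Num.sqrt _ _ _ (cvg_frob gX gX)).
exact: sqrt_continuous.
Qed.

(** Bridge between the topology of the max norm and epsilon estimates in the Frobenius norm. *)
Lemma cvg_frobP m n (T : Type) (F : set_system T) {FF : Filter F}
    (g : T -> 'M[R]_(m, n)) (X : 'M[R]_(m, n)) :
  g @ F --> X <->
  forall e : R, 0 < e -> \forall t \near F, frobnorm (g t - X) < e.
Proof.
split=> [gX e e0|gX].
  have : frobnorm (g t - X) @[t --> F] --> frobnorm (X - X).
    by apply: cvg_frobnorm; apply: cvgB => //; exact: cvg_cst.
  by rewrite subrr frobnorm0 => /cvgr_lt; apply.
apply: mx_cvg => i j; apply/cvgrPdist_lt => e e0.
apply: filterS (gX _ e0) => t; apply: le_lt_trans.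
by have := coord_le_frobnorm (g t - X) i j; rewrite !mxE distrC.
Qed.

(* Typeclass resolution does not find [nbhs_filter] through the entrywise
   [Filtered] structure that [nbhs X] elaborates to for a matrix [X]. *)
#[global] Instance mx_nbhs_filter m n (X : 'M[R]_(m, n)) : ProperFilter (nbhs X).
Proof. exact: (@nbhs_pfilter ('M[R]_(m, n) : topologicalType)). Qed.

Lemma nbhs_frobP m n (X : 'M[R]_(m, n)) (U : set 'M[R]_(m, n)) :
  nbhs X U <-> exists2 e : R, 0 < e & forall Y, frobnorm (Y - X) < e -> U Y.
Proof.
split=> [/nbhs_ballP[e /= e0 eU]|[e e0 eU]].
  exists e => // Y YX; apply: eU; split=> // i j; rewrite /ball/= distrC.
  by apply: le_lt_trans YX; have := coord_le_frobnorm (Y - X) i j; rewrite !mxE.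
have /cvg_frobP/(_ _ e0) : (id : 'M[R]_(m, n) -> _) @ nbhs X --> X by [].
by apply: filterS => Y; exact: eU.
Qed.

End FrobeniusNorm.

(** * Matrices of bounded rank and their tangent cones *)

Section RankGeometry.
Variable R : realType.

Lemma cvg_congr (T : Type) (U : topologicalType) (F : set_system T)
    (f : T -> U) (a b : U) : a = b -> f @ F --> a -> f @ F --> b.
Proof. by move=> ->. Qed.

Lemma mulmx_pinvmx m n (X : 'M[R]_(m, n)) : X *m pinvmx X *m X = X.
Proof. exact: mulmxKpV. Qed.

(** If [v *m A = 0] then [v = - (v *m (A - 1%:M))], so |v| <= |v| |A - 1| with |A - 1| < 1, which
    forces [v = 0]. *)
Lemma near1_unitmx n (A : 'M[R]_n) : frobnorm (A - 1%:M) < 1 -> A \in unitmx.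
Proof.
move=> A1; rewrite -row_free_unit -kermx_eq0; apply/rowV0P => v /sub_kermxP vA.
have vE : v = - (v *m (A - 1%:M)) by rewrite mulmxBr vA mulmx1 sub0r opprK.
apply: frobnorm_eq0; apply/le_anti; rewrite frobnorm_ge0 andbT.
have := frobnormM v (A - 1%:M); rewrite -frobnormN -vE => h.
by have := frobnorm_ge0 v; nra.
Qed.

Lemma cvg1_unitmx n (T : Type) (F : set_system T) {FF : Filter F}
    (g : T -> 'M[R]_n) :
  g @ F --> (1%:M : 'M[R]_n) -> \forall t \near F, g t \in unitmx.
Proof.
move=> /cvg_frobP/(_ 1 ltr01); apply: filterS => t; exact: near1_unitmx.
Qed.

Lemma cvg1_invmx n (T : Type) (F : set_system T) {FF : Filter F}
    (g : T -> 'M[R]_n) :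
  g @ F --> (1%:M : 'M[R]_n) -> invmx (g t) @[t --> F] --> (1%:M : 'M[R]_n).
Proof.
move=> g1; apply/cvg_frobP => e e0.
pose N := frobnorm (1%:M : 'M[R]_n); have N0 : 0 <= N by exact: frobnorm_ge0.
(* For x = |A^-1 - 1| and a = |A - 1| <= 1/2, the bound x <= a (x + N) proved below gives x <= 2 a
   N, whence this threshold; [N + 1] keeps the divisor positive. *)
have d0 : 0 < e / (2 * (N + 1)) by rewrite divr_gt0// mulr_gt0//; lra.
have h0 : 0 < 1 / 2 :> R by lra.
move/cvg_frobP : g1 => g1.
apply: filterS2 (g1 _ h0) (g1 _ d0) => t A1 Ae.
set A := g t in A1 Ae *; have Au : A \in unitmx by apply: near1_unitmx; lra.
have E : invmx A - 1%:M = - ((A - 1%:M) *m invmx A).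
  by rewrite mulmxBl mulmxV// mul1mx opprB.
have : frobnorm (invmx A - 1%:M) <= frobnorm (A - 1%:M) * frobnorm (invmx A).
  by rewrite E frobnormN frobnormM.
have : frobnorm (invmx A) <= frobnorm (invmx A - 1%:M) + N.
  by rewrite -{1}(subrK 1%:M (invmx A)) frobnormD.
move: Ae; rewrite ltr_pdivlMr ?mulr_gt0//; last lra.
have := frobnorm_ge0 (A - 1%:M); have := frobnorm_ge0 (invmx A - 1%:M).
set x := frobnorm (invmx A - _); set y := frobnorm (invmx A).
move: A1; set a := frobnorm _ => A1 x0 a0 ae yx xay.
have : x <= a * (x + N) by apply: le_trans xay _; rewrite ler_wpM2l.
by nra.
Qed.

Lemma mxrank_unitl m n (A : 'M[R]_m) (X : 'M[R]_(m, n)) :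
  A \in unitmx -> \rank (A *m X) = \rank X.
Proof. by move=> Au; rewrite (eqmxMfull X)// row_full_unit. Qed.

Lemma cvg_affine_left m n (X : 'M[R]_(m, n)) (W : 'M[R]_(n, m)) :
  (fun Y : 'M[R]_(m, n) => 1%:M + (Y - X) *m W) @ nbhs X --> (1%:M : 'M[R]_m).
Proof.
apply: (@cvg_congr _ _ _ _ (1%:M + (X - X) *m W)).
  by rewrite subrr mul0mx addr0.
apply: cvgD; first exact: cvg_cst.
by apply: cvg_mulmx; [apply: cvgB => //; exact: cvg_cst|exact: cvg_cst].
Qed.

Lemma mul_perturbation m n (X Y : 'M[R]_(m, n)) (W : 'M[R]_(n, m)) :
  X *m W *m X = X -> (1%:M + (Y - X) *m W) *m X = Y *m W *m X.
Proof.
by move=> XWX; rewrite mulmxDl mul1mx mulmxBl mulmxBl XWX addrC subrK.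
Qed.

(** Lower semicontinuity of the rank: with [W] a generalized inverse of [X], the factor 1 + (Y - X)
    W is invertible near [X] and sends [X] to Y W X, whose rank is at most that of [Y]. *)
Lemma mxrank_near m n (X : 'M[R]_(m, n)) :
  \forall Y \near nbhs X, (\rank X <= \rank Y)%N.
Proof.
have : \forall Y \near nbhs X, 1%:M + (Y - X) *m pinvmx X \in unitmx.
  by apply: cvg1_unitmx; exact: cvg_affine_left.
apply: filterS => Y Au; rewrite -(mxrank_unitl X Au).
by rewrite mul_perturbation ?mulmx_pinvmx// -mulmxA mxrankM_maxl.
Qed.

Lemma closed_rank_le m n r : closed (@rank_le R m n r).
Proof.
move=> X /(_ _ (mxrank_near X))[Y [/= Yr XY]]; exact: leq_trans Yr.
Qed.

(** Let A be the left factor and M = A^-1 Y. Then M W X = X, so the column space of [X] lies in that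
    of M; the ranks agree, so the two spaces coincide and X W M = M. Hence X (1 + W (M - X)) = M. *)
Lemma same_rank_factor m n (X Y : 'M[R]_(m, n)) (W : 'M[R]_(n, m)) :
  X *m W *m X = X -> 1%:M + (Y - X) *m W \in unitmx -> \rank Y = \rank X ->
  Y = (1%:M + (Y - X) *m W) *m X *m
      (1%:M + W *m (invmx (1%:M + (Y - X) *m W) *m Y - X)).
Proof.
move=> XWX; set A := 1%:M + _ => Au rYX.
have AX : A *m X = Y *m W *m X by exact: mul_perturbation.
set M := invmx A *m Y; have MWX : M *m W *m X = X.
  by rewrite /M -!mulmxA (mulmxA Y) -AX mulKmx.
have rM : \rank M = \rank X by rewrite mxrank_unitl ?unitmx_inv.
have sXM : (X^T <= M^T)%MS.
  by rewrite -{1}MWX -mulmxA trmx_mul submxMl.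
have : (M^T <= X^T)%MS.
  by rewrite -(geq_leqif (mxrank_leqif_sup sXM)) !mxrank_tr rM.
case/submxP => D /(congr1 trmx); rewrite trmxK trmx_mul trmxK => ME.
have XWM : X *m W *m M = M by rewrite ME mulmxA XWX.
have XB : X *m (1%:M + W *m (M - X)) = M.
  by rewrite mulmxDr mulmx1 mulmxA mulmxBr XWX XWM addrC subrK.
by rewrite -mulmxA XB mulKVmx.
Qed.

Lemma same_rank_near m n (X : 'M[R]_(m, n)) :
  exists (A : 'M[R]_(m, n) -> 'M[R]_m) (B : 'M[R]_(m, n) -> 'M[R]_n),
  [/\ A @ nbhs X --> (1%:M : 'M[R]_m), B @ nbhs X --> (1%:M : 'M[R]_n)
    & \forall Y \near nbhs X, \rank Y = \rank X -> Y = A Y *m X *m B Y].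
Proof.
pose W := pinvmx X; pose A Y := 1%:M + (Y - X) *m W.
have A1 : A @ nbhs X --> (1%:M : 'M[R]_m) by exact: cvg_affine_left.
exists A, (fun Y => 1%:M + W *m (invmx (A Y) *m Y - X)); split=> //.
  apply: (@cvg_congr _ _ _ _ (1%:M + W *m (1%:M *m X - X))).
    by rewrite mul1mx subrr mulmx0 addr0.
  apply: cvgD; first exact: cvg_cst.
  apply: cvg_mulmx; first exact: cvg_cst.
  by apply: cvgB; [apply: cvg_mulmx => //; exact: cvg1_invmx|exact: cvg_cst].
have : \forall Y \near nbhs X, A Y \in unitmx by exact: cvg1_unitmx.
apply: filterS => Y Au.
by apply: same_rank_factor => //; exact: mulmx_pinvmx.
Qed.

(** * Tangent cones to the variety of matrices of bounded rank *)

Section TangentCone.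
Variables m n r : nat.
Implicit Types (X Y Z V : 'M[R]_(m, n)) (W : 'M[R]_(n, m)).
Local Notation tangent := (tangent_cone (@rank_le R m n r)).

(** Left multiplication by X W + a (1 - X W) fixes [X], scales the component (1 - X W) V by [a], and
    cannot raise the rank. *)
Lemma rank_tangent_scale X W V a :
  X *m W *m X = X -> rank_le r (X + (1%:M - X *m W) *m V) ->
  rank_le r (X + (1%:M - X *m W) *m (a *: V)).
Proof.
move=> XWX; apply: leq_trans.
have PX : (1%:M - X *m W) *m X = 0 by rewrite mulmxBl mul1mx XWX subrr.
have PP : (1%:M - X *m W) *m (1%:M - X *m W) = 1%:M - X *m W.
  by rewrite mulmxBr mulmx1 mulmxA PX mul0mx subr0.
have XWP : X *m W *m (1%:M - X *m W) = 0.
  by rewrite mulmxBr mulmx1 mulmxA XWX subrr.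
have E : (X *m W + a *: (1%:M - X *m W)) *m (X + (1%:M - X *m W) *m V) =
    X + (1%:M - X *m W) *m (a *: V).
  rewrite mulmxDl !mulmxDr XWX mulmxA XWP mul0mx addr0 -!scalemxAl PX scaler0.
  by rewrite add0r mulmxA PP scalemxAr.
by rewrite -E; exact: mxrankM_maxr.
Qed.

Lemma rank_tangent_retract X W V :
  rank_le r (X + (1%:M - X *m W) *m V) ->
  rank_le r (X + V + (1%:M - X *m W) *m V *m W *m V).
Proof.
apply: leq_trans.
have E : (X + (1%:M - X *m W) *m V) *m (1%:M + W *m V) =
    X + V + (1%:M - X *m W) *m V *m W *m V.
  rewrite mulmxDr mulmx1 [(X + _) *m _]mulmxDl !mulmxA.
  by rewrite {1}mulmxBl mul1mx -!addrA addKr.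
by rewrite -E; exact: mxrankM_maxl.
Qed.

(** Allowing any generalized inverse [W] matters in [tangent_retract_near], where it has to vary
    continuously with the base point. *)
Lemma tangent_rankP X W V : X *m W *m X = X ->
  tangent X V <-> rank_le r (X + (1%:M - X *m W) *m V).
Proof.
move=> XWX; split=> [[Xs [t [SXs Xs_X t0 tV]]]|rV].
  have PX : (1%:M - X *m W) *m X = 0 by rewrite mulmxBl mul1mx XWX subrr.
  (* Rescaling the complement of the range of X by 1/t turns Xs i = X + t V + o(t)
     into a matrix of the same rank that converges to X + (1 - X W) V. *)
  pose E i := X *m W + (t i)^-1 *: (1%:M - X *m W).
  have EX i : E i *m Xs i = X + (X *m W *m (Xs i - X) +
      (1%:M - X *m W) *m ((t i)^-1 *: (Xs i - X))).
    have -> : X *m W *m (Xs i - X) = X *m W *m Xs i - X by rewrite mulmxBr XWX.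
    rewrite -scalemxAr [_ *m (_ - _)]mulmxBr PX subr0 scalemxAl mulmxDl.
    by rewrite [in RHS]addrA [X + _]addrC subrK.
  have : E i *m Xs i @[i --> \oo] -->
      X + (X *m W *m (X - X) + (1%:M - X *m W) *m V).
    under eq_cvg do rewrite EX.
    apply: cvgD; first exact: cvg_cst.
    apply: cvgD; apply: cvg_mulmx => //; try exact: cvg_cst.
    by apply: cvgB => //; exact: cvg_cst.
  rewrite subrr mulmx0 add0r.
  apply: (closed_cvg _ (@closed_rank_le m n r)); apply: nearW => i.
  exact: leq_trans (mxrankM_maxr _ _) (SXs i).
(* Conversely, the curve X + t V + t^2 Q stays in the variety by scaling and retraction, and its
   quadratic term vanishes in the difference quotient as t tends to 0. *)
pose t i : R := harmonic i; have t_0 : t @ \oo --> (0 : R) by exact: cvg_harmonic.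
have t0 i : 0 < t i by exact: harmonic_gt0.
pose Q := (1%:M - X *m W) *m V *m W *m V.
have QE a : (1%:M - X *m W) *m (a *: V) *m W *m (a *: V) = (a * a) *: Q.
  by rewrite /Q -!scalemxAr -!scalemxAl scalerA.
exists (fun i => X + t i *: V + (t i * t i) *: Q), t; split=> //.
- by move=> i; rewrite -QE; apply: rank_tangent_retract; exact: rank_tangent_scale.
- apply: (@cvg_congr _ _ _ _ (X + (0 : R) *: V + ((0 : R) * 0) *: Q)).
    by rewrite mulr0 !scale0r !addr0.
  apply: cvgD; first (apply: cvgD; first exact: cvg_cst).
    by apply: cvgZ => //; exact: cvg_cst.
  by apply: cvgZ; [exact: cvgM|exact: cvg_cst].
- apply: (@cvg_congr _ _ _ _ (V + (0 : R) *: Q)); first by rewrite scale0r addr0.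
  have tE i : (t i)^-1 *: (X + t i *: V + (t i * t i) *: Q - X) = V + t i *: Q.
    rewrite -(addrA X) [X + _]addrC addrK scalerDr !scalerA.
    by rewrite mulVf ?gt_eqF// scale1r mulrA mulVf ?gt_eqF// mul1r.
  under eq_cvg do rewrite tE.
  by apply: cvgD; [exact: cvg_cst|apply: cvgZ => //; exact: cvg_cst].
Qed.

Lemma tangent0 X : rank_le r X -> tangent X 0.
Proof.
by move=> Xr; apply/(tangent_rankP _ (mulmx_pinvmx X)); rewrite mulmx0 addr0.
Qed.

Lemma closed_tangent X : closed (tangent X).
Proof.
pose g V := X + (1%:M - X *m pinvmx X) *m V.
have -> : tangent X = g @^-1` (@rank_le R m n r).
  by apply/seteqP; split=> V /(tangent_rankP _ (mulmx_pinvmx X)).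
apply: preimage_closed => [V _|]; last exact: closed_rank_le.
apply: cvgD; first exact: cvg_cst.
by apply: cvg_mulmx => //; exact: cvg_cst.
Qed.

Lemma tangent_mul X V (A : 'M[R]_m) (B : 'M[R]_n) :
  tangent X V -> tangent (A *m X *m B) (A *m V *m B).
Proof.
case=> Xs [t [SXs Xs_X t0 tV]].
have AB (u : nat -> 'M[R]_(m, n)) (Z : 'M[R]_(m, n)) :
    u @ \oo --> Z -> A *m u i *m B @[i --> \oo] --> A *m Z *m B.
  move=> uZ; apply: cvg_mulmx; last exact: cvg_cst.
  by apply: cvg_mulmx => //; exact: cvg_cst.
exists (fun i => A *m Xs i *m B), t; split=> //.
- move=> i; apply: leq_trans (mxrankM_maxl _ _) _.
  exact: leq_trans (mxrankM_maxr _ _) (SXs i).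
- exact: AB.
- have tE i : (t i)^-1 *: (A *m Xs i *m B - A *m X *m B) =
      A *m ((t i)^-1 *: (Xs i - X)) *m B.
    by rewrite -mulmxBl -mulmxBr -scalemxAr -scalemxAl.
  under eq_cvg do rewrite tE.
  exact: (AB (fun i => (t i)^-1 *: (Xs i - X))).
Qed.

(** A tangent vector is transported along the stratum of constant rank as A V B, where Y = A X B. *)
Lemma tangent_near X V : tangent X V ->
  exists2 VY : 'M[R]_(m, n) -> 'M[R]_(m, n), VY @ nbhs X --> V &
  \forall Y \near nbhs X, \rank Y = \rank X -> tangent Y (VY Y).
Proof.
move=> TV; have [A [B [A1 B1 YE]]] := same_rank_near X.
exists (fun Y => A Y *m V *m B Y).
  apply: (@cvg_congr _ _ _ _ (1%:M *m V *m 1%:M)); first by rewrite mulmx1 mul1mx.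
  apply: cvg_mulmx => //; apply: cvg_mulmx => //=; exact: cvg_cst.
by apply: filterS YE => Y YE /YE {1}->; exact: tangent_mul.
Qed.

Lemma tangent_retract_near X :
  exists2 K : R, 0 < K & \forall Y \near nbhs X, \rank Y = \rank X ->
  forall V, tangent Y V ->
  exists2 Z, rank_le r Z & frobnorm (Z - (Y + V)) <= K * frobnorm V ^+ 2.
Proof.
have [A [B [A1 B1 YE]]] := same_rank_near X.
(* For Y = A X B this is a generalized inverse of [Y] that tends to [pinvmx X], so the constant
   [k Y] of the second order bound stays bounded near [X]. *)
pose W Y := invmx (B Y) *m pinvmx X *m invmx (A Y).
have cW : W @ nbhs X --> pinvmx X.
  apply: (@cvg_congr _ _ _ _ (1%:M *m pinvmx X *m 1%:M)).
    by rewrite mulmx1 mul1mx.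
  apply: cvg_mulmx; last exact: cvg1_invmx.
  by apply: cvg_mulmx; [exact: cvg1_invmx|exact: cvg_cst].
pose k Y := frobnorm (1%:M - Y *m W Y) * frobnorm (W Y).
pose K := frobnorm (1%:M - X *m pinvmx X) * frobnorm (pinvmx X).
have ck : k @ nbhs X --> K.
  apply: cvgM; last exact: cvg_frobnorm.
  apply: cvg_frobnorm; apply: cvgB; first exact: cvg_cst.
  exact: cvg_mulmx.
have K0 : 0 <= K by rewrite mulr_ge0 ?frobnorm_ge0.
exists (K + 1); first lra.
have kK : \forall Y \near nbhs X, k Y < K + 1 by apply: (cvgr_lt _ ck); lra.
have Au : \forall Y \near nbhs X, A Y \in unitmx by exact: cvg1_unitmx.
have Bu : \forall Y \near nbhs X, B Y \in unitmx by exact: cvg1_unitmx.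
apply: filterS3 (filterI kK YE) Au Bu => Y [{}kK {}YE] Au Bu /YE {}YE V TV.
have YWY : Y *m W Y *m Y = Y.
  rewrite /W; move: (A Y) (B Y) Au Bu YE => a b au bu ->.
  have := mulmx_pinvmx X; move: (pinvmx X) => P XPX.
  by rewrite !mulmxA mulmxK// mulmxKV// -!(mulmxA a) XPX.
move/(tangent_rankP _ YWY)/rank_tangent_retract : TV; set Q := _ *m V => TV.
exists (Y + V + Q) => //; rewrite addrAC subrr add0r.
apply: le_trans (_ : k Y * frobnorm V ^+ 2 <= _); last first.
  by rewrite ler_wpM2r ?sqr_ge0// ltW.
have -> : k Y * frobnorm V ^+ 2 =
  frobnorm (1%:M - Y *m W Y) * frobnorm V * frobnorm (W Y) * frobnorm V.
  by rewrite /k; ring.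
rewrite (le_trans (frobnormM _ _))// ler_wpM2r ?frobnorm_ge0//.
rewrite (le_trans (frobnormM _ _))// ler_wpM2r ?frobnorm_ge0//.
by rewrite frobnormM.
Qed.

End TangentCone.
End RankGeometry.

(** * Singular values larger than Delta *)

Section SymmetricSpectrum.
Variable R : realType.

(** Dividing by the full power of 'X - l lowers the degree by the multiplicity of [l] and leaves the
    multiplicities of the other points unchanged. *)
Lemma sum_mup_le (p : {poly R}) (s : seq R) : p != 0 -> uniq s ->
  (\sum_(l <- s) mup l p <= (size p).-1)%N.
Proof.
elim: s p => [|l s IHs] p p0 /=; first by rewrite big_nil.
move=> /andP[ls us]; rewrite big_cons.
have /dvdpP[q pE] : ('X - l%:P) ^+ mup l p %| p by rewrite -mup_geq.
have q0 : q != 0 by apply: contraNneq p0 => q0; rewrite pE q0 mul0r.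
have -> : (\sum_(j <- s) mup j p = \sum_(j <- s) mup j q)%N.
  apply: eq_big_seq => j js; rewrite {1}pE mupMl//.
  rewrite /root horner_exp hornerXsubC expf_eq0 subr_eq0 negb_and.
  by apply/orP; right; apply: contraNneq ls => <-.
have -> : ((size p).-1 = mup l p + (size q).-1)%N.
  rewrite {1}pE size_Mmonic ?monic_exp ?monicXsubC// size_exp_XsubC addnS/=.
  by rewrite addnC -[in LHS](prednK (n := size q)) ?size_poly_gt0// addnS.
by rewrite leq_add2l IHs.
Qed.

(** The rows of [W] and [W'] together form a basis in which [A] becomes block diagonal. *)
Lemma char_poly_split n k k' (e : (k + k' = n)%N) (A : 'M[R]_n)
    (W : 'M[R]_(k, n)) (W' : 'M[R]_(k', n)) (A1 : 'M[R]_k) (A2 : 'M[R]_k') :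
  W *m A = A1 *m W -> W' *m A = A2 *m W' -> row_free (col_mx W W') ->
  char_poly A = char_poly A1 * char_poly A2.
Proof.
move: e A W W' => <- {n} A W W' WA WA'; rewrite row_free_unit.
set P := col_mx W W' => Pu.
have PA : P *m A = block_mx A1 0 0 A2 *m P.
  by rewrite mul_col_mx mul_block_col !mul0mx addr0 add0r WA WA'.
have detP : \det (map_mx polyC P) != 0 :> {poly R}.
  by rewrite det_map_mx polyC_eq0 -unitfE -unitmxE.
apply: (mulfI detP); rewrite -/(char_poly_mx A) -det_mulmx.
have -> : map_mx polyC P *m char_poly_mx A =
    char_poly_mx (block_mx A1 0 0 A2) *m map_mx polyC P.
  rewrite /char_poly_mx mulmxBr mulmxBl -!map_mxM PA; congr (_ - _).
  exact: scalar_mxC.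
by rewrite det_mulmx char_block_diag_mx det_ublock mulrC.
Qed.

Lemma frob_mull m n p (X : 'M[R]_(m, n)) (M : 'M[R]_(n, p)) (Y : 'M[R]_(m, p)) :
  frob (X *m M) Y = frob X (Y *m M^T).
Proof. by rewrite /frob trmx_mul trmxK mulmxA mxtrace_mulC mulmxA. Qed.

Lemma frobnorm_tr m n (X : 'M[R]_(m, n)) : frobnorm X^T = frobnorm X.
Proof. by rewrite /frobnorm /frob trmxK mxtrace_mulC. Qed.

Lemma mulmx_tr_eq0 n (v : 'rV[R]_n) : v *m v^T = 0 -> v = 0.
Proof.
move=> vv; apply: frobnorm_eq0.
by rewrite -frobnorm_tr /frobnorm /frob trmxK vv mxtrace0 sqrtr0.
Qed.

Section Symmetric.
Variables (n : nat) (A : 'M[R]_n).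
Hypothesis symA : A^T = A.

Lemma orthogonal_stable k k' (W : 'M[R]_(k, n)) (W' : 'M[R]_(k', n)) A1 :
  W *m A = A1 *m W -> W' *m W^T = 0 -> W' *m A *m W^T = 0.
Proof.
move=> WA WW'; rewrite -mulmxA -{1}symA -trmx_mul WA trmx_mul mulmxA WW'.
exact: mul0mx.
Qed.

(* The orthogonal complement of the sum of the eigenspaces is stable under [A],
   and no [l \in s] is an eigenvalue of [A] there. *)
Lemma sum_mup_sym (s : seq R) : uniq s ->
  (\sum_(l <- s) mup l (char_poly A) <=
   \rank (\sum_(i < size s) eigenspace A s`_i)%MS)%N.
Proof.
move=> us; set E := (\sum_(i < _) _)%MS.
pose W := row_base E; pose W' := row_base (kermx W^T).
have WW' : W' *m W^T = 0 by apply/sub_kermxP; rewrite eq_row_base.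
have EA : (E *m A <= E)%MS.
  rewrite sumsmxMr; apply/sumsmx_subP => i _.
  have /eigenspaceP -> := submx_refl (eigenspace A s`_i).
  by rewrite scalemx_sub// (sumsmx_sup i).
have WA : W *m A = (W *m A *m pinvmx W) *m W.
  rewrite mulmxKpV//; apply: (@submx_trans _ _ _ _ _ _ E).
  2: by rewrite eq_row_base.
  by apply: submx_trans EA; rewrite submxMr// eq_row_base.
have W'A : W' *m A = (W' *m A *m pinvmx W') *m W'.
  rewrite mulmxKpV// eq_row_base; apply/sub_kermxP.
  exact: orthogonal_stable WA WW'.
have cap0 : (W :&: W')%MS = 0.
  apply/eqP/rowV0P => v; rewrite sub_capmx => /andP[/submxP[u ->]].
  rewrite eq_row_base => /sub_kermxP uW.
  by apply: mulmx_tr_eq0; rewrite trmx_mul mulmxA uW mul0mx.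
have rW : \rank W = \rank E by rewrite eq_row_base.
have e : (\rank E + \rank (kermx W^T) = n)%N.
  by rewrite mxrank_ker mxrank_tr rW subnKC// rank_leq_col.
have free : row_free (col_mx W W').
  by rewrite /row_free -addsmxE (mxrank_disjoint_sum cap0) !eq_row_base.
rewrite (char_poly_split e WA W'A free).
set A1 := W *m A *m _; set A2 := W' *m A *m _ in W'A *.
(* An eigenvector of [A2] for [l] lifts to an eigenvector of [A] in the orthogonal complement [W'].
   It also lies in the eigenspace of [l], hence in [W], so it is orthogonal to itself and
   vanishes. *)
have nroot l : l \in s -> ~~ root (char_poly A2) l.
  move=> ls; apply/negP; rewrite -eigenvalue_root_char => /eigenvalueP[v vA v0].
  move/eqP: v0; apply; apply: (row_free_inj (row_base_free (kermx W^T))).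
  rewrite mul0mx; set w := v *m W'.
  have : (w <= W)%MS.
    rewrite eq_row_base; have ls' : (index l s < size s)%N by rewrite index_mem.
    apply: (sumsmx_sup (Ordinal ls')) => //=; rewrite nth_index//.
    by apply/eigenspaceP; rewrite /w -mulmxA W'A mulmxA vA -scalemxAl.
  case/submxP => u wu; apply: mulmx_tr_eq0.
  by rewrite {2}wu trmx_mul mulmxA /w -(mulmxA v) WW' mulmx0 mul0mx.
have -> : (\sum_(l <- s) mup l (char_poly A1 * char_poly A2) =
    \sum_(l <- s) mup l (char_poly A1))%N.
  by apply: eq_big_seq => l ls; rewrite mupMl ?nroot.
(* All the multiplicities come from [A1], whose size is the rank of [E]. *)
have := @sum_mup_le (char_poly A1) s; rewrite size_char_poly; apply => //.
by rewrite monic_neq0 ?char_poly_monic.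
Qed.

(** Eigenvectors of a symmetric matrix for distinct eigenvalues are orthogonal, so both sides become
    weighted sums of the squared norms of the components of [v]. *)
Lemma frob_eigenspaces_ge (s : seq R) (c : R) (v : 'rV[R]_n) :
  uniq s -> {in s, forall l, c <= l} ->
  (v <= \sum_(i < size s) eigenspace A s`_i)%MS ->
  c * frob v v <= frob (v *m A) v.
Proof.
move=> us sc /sub_sumsmxP[u vE]; pose w i := u i *m eigenspace A s`_i.
have wA i : w i *m A = s`_i *: w i by apply/eigenspaceP; exact: submxMl.
have ortho (i j : 'I_(size s)) : i != j -> frob (w i) (w j) = 0.
  move=> ij; have := frob_mull (w i) A (w j).
  rewrite symA !wA frobZl frobZr => /eqP; rewrite -subr_eq0 -mulrBl mulf_eq0.
  rewrite subr_eq0 nth_uniq// => /orP[/eqP/val_inj/eqP|/eqP//].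
  by rewrite (negPf ij).
have frob_sum (a : 'I_(size s) -> R) :
    frob (\sum_i a i *: w i) v = \sum_i a i * frob (w i) (w i).
  have linl : {morph (fun X => frob X v) : X Y / X + Y} by move=> *; rewrite frobDl.
  rewrite (big_morph _ linl (frob0l v)); apply: eq_bigr => i _.
  rewrite frobZl; congr (_ * _); rewrite vE.
  have linr : {morph (fun X => frob (w i) X) : X Y / X + Y}.
    by move=> *; rewrite frobDr.
  rewrite (big_morph _ linr (frob0r _)) (bigD1 i)//= big1 ?addr0// => j ji.
  by rewrite ortho// eq_sym.
have vA : v *m A = \sum_(i < size s) s`_i *: w i.
  by rewrite vE mulmx_suml; apply: eq_bigr => i _; rewrite -wA.
have -> : c * frob v v = frob (\sum_i c *: w i) v by rewrite -scaler_sumr -vE frobZl.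
rewrite vA !frob_sum; apply: ler_sum => i _.
by rewrite ler_wpM2r ?frob_ge0// sc// mem_nth.
Qed.

End Symmetric.

(** Otherwise the sum of the eigenspaces of Y^T Y for eigenvalues above Delta^2 meets the kernel of
    [X] in some v != 0. There |v Y^T| >= Delta |v|, although v Y^T = v (Y - X)^T has norm below
    Delta |v|. *)
Lemma rank_Delta_le m n (Delta : R) (X Y : 'M[R]_(m, n)) : 0 < Delta ->
  frobnorm (Y - X) < Delta -> (rank_Delta Delta Y <= \rank X)%N.
Proof.
move=> D0 YX; pose A := Y^T *m Y; have symA : A^T = A by rewrite trmx_mul trmxK.
pose s := [seq l <- rootsR (char_poly A) | Delta < Num.sqrt l].
have us : uniq s by rewrite filter_uniq// uniq_roots.
have sD : {in s, forall l, Delta ^+ 2 <= l}.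
  move=> l; rewrite mem_filter => /andP[Dl _].
  have l0 : 0 < l by rewrite -sqrtr_gt0; exact: lt_trans Dl.
  by rewrite -(sqr_sqrtr (ltW l0)) ler_sqr ?nnegrE ?sqrtr_ge0// ltW.
have -> : rank_Delta Delta Y = (\sum_(l <- s) mup l (char_poly A))%N.
  rewrite /rank_Delta /singular_values count_flatten sumnE !big_map big_filter.
  rewrite [RHS]big_mkcond/=; apply: eq_bigr => l _.
  by rewrite count_nseq; case: ifP; rewrite ?mul1n ?mul0n.
apply: leq_trans (sum_mup_sym symA us) _; set E := (\sum_(i < _) _)%MS.
rewrite leqNgt; apply/negP => rE.
have /rowV0Pn[v] : (E :&: kermx X^T)%MS != 0.
  rewrite -mxrank_eq0 -lt0n -(ltn_add2l (\rank (E *m X^T))) addn0 mxrank_mul_ker.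
  by apply: leq_ltn_trans rE; rewrite -(mxrank_tr X) mxrankM_maxr.
rewrite sub_capmx => /andP[vE /sub_kermxP vX] v0.
have := frob_eigenspaces_ge symA us sD vE.
rewrite /A mulmxA frob_mull -!frobnorm_sqr.
have -> : v *m Y^T = v *m (Y - X)^T by rewrite linearB/= mulmxBr vX subr0.
have vp : 0 < frobnorm v.
  by rewrite lt_def frobnorm_ge0 andbT; apply: contra_neq v0 => /frobnorm_eq0.
have := frobnormM v (Y - X)^T; rewrite frobnorm_tr.
have := frobnorm_ge0 (v *m (Y - X)^T); have := frobnorm_ge0 (Y - X).
move: YX; set a := frobnorm (Y - X); set b := frobnorm (_ *m _).
move=> aD a0 b0 bva; apply/negP; rewrite -ltNge -exprMn ltr_sqr ?nnegrE//.
  by apply: le_lt_trans bva _; rewrite mulrC ltr_pM2r.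
by rewrite mulr_ge0// ltW.
Qed.

End SymmetricSpectrum.

(** * Projections and backtracking *)

Section Projection.
Variables (R : realType) (m n : nat).
Implicit Types (X Y Z V W G : 'M[R]_(m, n)) (S : set 'M[R]_(m, n)).

(** The points of [S] at most as far from [X] as a given [Z0] form a closed bounded set. Flattened
    to row vectors it is compact, so the distance attains its minimum. *)
Lemma proj_nonempty S X : closed S -> S !=set0 -> exists Y, proj S X Y.
Proof.
move=> clS [Z0 SZ0]; pose h (v : 'rV[R]_(m * n)) := frobnorm (X - vec_mx v).
have cvec : continuous (vec_mx : 'rV[R]_(m * n) -> 'M[R]_(m, n)).
  move=> v; apply: mx_cvg => i j; rewrite mxE.
  rewrite (_ : (fun _ => _) = (fun w : 'rV[R]_(m * n) => w 0 (mxvec_index i j))).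
    exact: coord_continuous.
  by apply/funext => w; rewrite mxE.
have ch : continuous h.
  move=> v; apply: cvg_frobnorm; apply: cvgB; first exact: cvg_cst.
  exact: cvec.
pose K := [set v | S (vec_mx v) /\ h v <= h (mxvec Z0)].
have K0 : K !=set0 by exists (mxvec Z0); split=> //; rewrite mxvecK.
have cK : compact K.
  apply: bounded_closed_compact.
    exists (frobnorm X + h (mxvec Z0)); split=> [|M hM v [_ vh]].
      exact: num_real.
    apply: le_trans (ltW hM); rewrite [leLHS]/Num.norm/= mx_normrE.
    apply/bigmax_leP; split=> [|[i k] _]/=.
      by rewrite addr_ge0 ?frobnorm_ge0.
    case/mxvec_indexP: k => k l; rewrite (ord1 i).
    have -> : v 0 (mxvec_index k l) = vec_mx v k l by rewrite mxE.
    apply: le_trans (coord_le_frobnorm _ _ _) _.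
    have -> : vec_mx v = X - (X - vec_mx v) by rewrite opprB addrC subrK.
    by apply: le_trans (frobnormD _ _) _; rewrite frobnormN lerD2l.
  apply: closedI.
    by apply: preimage_closed clS => v _; exact: cvec.
  apply: (preimage_closed (D := [set x | x <= h (mxvec Z0)])).
    by move=> v _; exact: ch.
  exact: closed_le.
have [v vK vmin] := compact_EVT_min K0 cK (continuous_subspaceT ch).
have [Sv hv] : K v by rewrite -inE.
exists (vec_mx v); split=> // Z SZ.
have [ZZ0|ZZ0] := leP (frobnorm (X - Z)) (h (mxvec Z0)).
  have := vmin (mxvec Z); rewrite /h mxvecK; apply; rewrite inE.
  by split; [rewrite mxvecK|rewrite {1}/h mxvecK].
by apply: le_trans hv _; exact: ltW.
Qed.

(** Expanding the squared distances from Y + W, the common term |W|^2 cancels. *)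
Lemma proj_ineq S Y W Z Z' : proj S (Y + W) Z -> S Z' ->
  frob (Z - Y) (Z - Y) - 2 * frob W (Z - Y) <=
  frob (Z' - Y) (Z' - Y) - 2 * frob W (Z' - Y).
Proof.
case=> _ Zmin /Zmin; rewrite ler_sqrt ?frob_ge0//.
have E T : Y + W - T = W - (T - Y) by rewrite opprB addrA [Y + W]addrC.
by rewrite !E !frob_subsqr; lra.
Qed.

Lemma proj_step S Y W Z : S Y -> proj S (Y + W) Z ->
  frob (Z - Y) (Z - Y) <= 2 * frob W (Z - Y).
Proof. by move=> SY /proj_ineq/(_ SY); rewrite subrr frob0l frob0r; lra. Qed.

Lemma proj_step_norm S Y W Z : S Y -> proj S (Y + W) Z ->
  frobnorm (Z - Y) <= 2 * frobnorm W.
Proof.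
move=> SY /(proj_step SY); have := frobnorm_CS W (Z - Y).
rewrite -frobnorm_sqr; have := frobnorm_ge0 (Z - Y); have := frobnorm_ge0 W.
by nra.
Qed.

(** On the ray through [G] the squared distance to [Z] is minimal at scale 1. Comparing with the
    scales 1 + d and 1 - d for small d gives the two inequalities. *)
Lemma proj_cone_frob S Z G : (forall a V, 0 < a -> S V -> S (a *: V)) ->
  proj S Z G -> frob Z G = frob G G.
Proof.
move=> Scone [SG Gmin].
have quad a : 0 < a -> 0 <= (a - 1) * ((a + 1) * frob G G - 2 * frob Z G).
  move=> a0; have := Gmin _ (Scone _ _ a0 SG).
  by rewrite ler_sqrt ?frob_ge0// !frob_subsqr frobZr frobZl frobZr; nra.
have p0 := frob_ge0 G; set p := frob G G in quad p0 *; set q := frob Z G in quad *.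
apply/le_anti/andP; split; apply/ler_addgt0Pr => e e0.
  pose d := e / (p + 1); have d0 : 0 < d by rewrite divr_gt0//; lra.
  have dp : d * (p + 1) = e by rewrite divfK//; lra.
  have := quad (1 + d) ltac:(lra); rewrite addrAC subrr add0r pmulr_rge0//.
  by nra.
(* The additional [e] ensures d < 1, so that the scale 1 - d is positive. *)
pose d := e / (p + 1 + e); have d0 : 0 < d by rewrite divr_gt0//; lra.
have dp : d * (p + 1 + e) = e by rewrite divfK//; lra.
have d1 : d < 1 by rewrite ltr_pdivrMr; lra.
have := quad (1 - d) ltac:(lra).
rewrite (_ : 1 - d - 1 = - d); last by ring.
by rewrite mulNr oppr_ge0 pmulr_rle0//; nra.
Qed.

End Projection.

Section Backtracking.
Variables (R : realType) (T : Type) (beta : R) (cand : R -> set T).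
Variables (reject : R -> T -> Prop).
Hypothesis beta_gt0 : 0 < beta.

(** The step returned is either the initial one or [beta] times a rejected one, and rejected steps
    exceed [b]. *)
Lemma backtracking_accept (b a : R) (Y : T) :
  (forall a' Y', 0 < a' -> a' <= b -> cand a' Y' -> ~ reject a' Y') ->
  0 < a -> backtracking beta cand reject a Y ->
  exists a', [/\ 0 < a', Num.min a (beta * b) <= a', cand a' Y & ~ reject a' Y].
Proof.
move=> acc a0 bt; elim: bt a0 => {a Y} [a Y cY rY a0|a Y Z cY rY _ IH a0].
  by exists a; split=> //; rewrite ge_min lexx.
have [a' [a'0 a'm cZ rZ]] := IH (mulr_gt0 a0 beta_gt0).
exists a'; split=> //; apply: le_trans a'm; rewrite le_min.
have ba : b < a by rewrite ltNge; apply/negP => /(acc _ _ a0)/(_ cY).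
by rewrite !ge_min lexx orbT andbT [a * beta]mulrC ler_pM2l// (ltW ba) orbT.
Qed.

(** Since beta^k tends to 0, finitely many reductions bring the step below [b]; the induction is on
    their number. *)
Lemma backtracking_ex (b a : R) : beta < 1 -> 0 < b ->
  (forall a', 0 < a' -> exists Y, cand a' Y) ->
  (forall a' Y', 0 < a' -> a' <= b -> cand a' Y' -> ~ reject a' Y') ->
  0 < a -> exists Y, backtracking beta cand reject a Y.
Proof.
move=> beta_lt1 b0 cand0 acc a0.
have [k] : exists k, a * beta ^+ k <= b.
  have /cvgrPdist_lt/(_ (b / a) (divr_gt0 b0 a0)) :
      (fun k => beta ^+ k) @ \oo --> (0 : R).
    by apply: cvg_expr; rewrite ger0_norm// ltW.
  case=> k _ /(_ k (leqnn k)); rewrite /= sub0r normrN => h; exists k.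
  rewrite mulrC -ler_pdivlMr//; apply: le_trans (ltW h); exact: ler_norm.
elim: k a a0 => [|k IHk] a a0 ab; have [Y cY] := cand0 a a0.
  exists Y; apply: backtracking_stop => //.
  by apply: acc cY => //; rewrite expr0 mulr1 in ab.
have [rY|rY] := pselect (reject a Y); last by exists Y; exact: backtracking_stop.
have [|Z bZ] := IHk (a * beta) (mulr_gt0 a0 beta_gt0).
  by rewrite -mulrA -exprS.
by exists Z; exact: backtracking_step rY bZ.
Qed.

End Backtracking.

(** * The descent lemma *)

Section LocalDescent.
Variables (R : realType) (m n : nat) (f : 'M[R]_(m, n) -> R).
Hypothesis f_diff : forall X, differentiable f X.
Hypothesis gradf_lip : locally_lipschitz (grad f).
Implicit Types (X Y Z V W G : 'M[R]_(m, n)).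

Lemma cvg_grad X : grad f @ nbhs X --> grad f X.
Proof.
have [U [L [/nbhs_frobP[e e0 eU] UL]]] := gradf_lip X.
have UX : U X by apply: eU; rewrite subrr frobnorm0.
apply/cvg_frobP => d d0.
have L1 : 0 < `|L| + 1 by rewrite ltr_wpDl.
apply/nbhs_frobP; exists (Num.min e (d / (`|L| + 1))).
  by rewrite lt_min e0 divr_gt0.
move=> Y; rewrite lt_min ltr_pdivlMr// => /andP[Ye Yd].
apply: le_lt_trans (UL _ _ (eU _ Ye) UX) _; apply: le_lt_trans Yd.
rewrite mulrC ler_wpM2l ?frobnorm_ge0//.
by rewrite (le_trans (ler_norm _))// lerDl.
Qed.

Lemma is_derive_segment X V (t : R) :
  is_derive t 1 (fun s : R => f (X + s *: V)) (frob (grad f (X + t *: V)) V).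
Proof.
have E : (fun h : R => h^-1 *: (((fun s : R => f (X + s *: V)) \o shift t) (h *: 1)
      - f (X + t *: V))) =
    (fun h : R => h^-1 *: ((f \o shift (X + t *: V)) (h *: V) - f (X + t *: V))).
  apply/funext => h /=; congr (_ *: (f _ - _)).
  by rewrite [h *: 1]mulr1 scalerDl addrCA.
have df : derivable f (X + t *: V) V by exact: diff_derivable.
apply: DeriveDef; first by rewrite /derivable E.
by rewrite /derive E -gradP -deriveE.
Qed.

(** The mean value theorem on the segment from [Y] to [Z] reduces the claim to a gradient
    difference, bounded by Cauchy-Schwarz and the Lipschitz estimate. This yields the constant L
    instead of the sharper L/2. *)
Lemma descent_near X : exists2 L : R, 0 < L & exists2 e : R, 0 < e &
  forall Y Z, frobnorm (Y - X) < e -> frobnorm (Z - X) < e ->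
  f Z <= f Y + frob (grad f Y) (Z - Y) + L * frob (Z - Y) (Z - Y).
Proof.
have [U [L [/nbhs_frobP[e e0 eU] UL]]] := gradf_lip X.
exists (`|L| + 1); first by rewrite ltr_wpDl.
exists e => // Y Z YX ZX; pose V := Z - Y.
pose F (t : R) := f (Y + t *: V).
have dF (t : R) : is_derive t 1 F (frob (grad f (Y + t *: V)) V).
  exact: is_derive_segment.
have cF : {within `[0, 1], continuous F}.
  by apply: derivable_within_continuous => t _; case: (dF t).
have [t] := MVT ltr01 (fun t _ => dF t) cF.
rewrite in_itv/= => /andP[t0 t1].
rewrite /F scale1r scale0r addr0 /V [Y + _]addrC subrK subr0 mulr1 -/V => fE.
have -> : f Z = f Y + frob (grad f (Y + t *: V)) V by rewrite -fE addrC subrK.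
have tU : U (Y + t *: V).
  (* The intermediate point stays in the ball around [X] because balls are convex. *)
  apply: eU; have -> : Y + t *: V - X = (1 - t) *: (Y - X) + t *: (Z - X).
    have -> : Z - X = V + (Y - X) by rewrite /V addrA subrK.
    rewrite addrAC [LHS]addrC; move: (Y - X) => D.
    by rewrite [t *: (V + D)]scalerDr addrCA -scalerDl subrK scale1r.
  apply: le_lt_trans (frobnormD _ _) _; rewrite !frobnormZ !gtr0_norm//; last lra.
  have -> : e = (1 - t) * e + t * e by ring.
  by rewrite ltrD// ltr_pM2l//; lra.
rewrite -addrA lerD2l -lerBlDl -frobBl.
apply: le_trans (frobnorm_CS _ _) _.
have := UL _ _ tU (eU _ YX).
have -> : Y + t *: V - Y = t *: V by rewrite [Y + _]addrC addrK.
rewrite frobnormZ gtr0_norm//.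
rewrite -frobnorm_sqr; set a := frobnorm (_ - _); set b := frobnorm V.
have b0 : 0 <= b by exact: frobnorm_ge0.
move=> ab; have aLb : a <= `|L| * b.
  apply: le_trans ab _; apply: le_trans (_ : `|L| * (t * b) <= _).
    by rewrite ler_wpM2r ?ler_norm// mulr_ge0// ltW.
  by rewrite ler_wpM2l// ler_piMl// ltW.
rewrite expr2 mulrA ler_wpM2r// (le_trans aLb)// ler_wpM2r//.
by rewrite lerDl.
Qed.

End LocalDescent.

(** * Local decrease of the two maps *)

(* Conversion tests between distinct [frob] terms are very slow, so they are
   generalized before the linear arithmetic procedure compares atoms. *)
Ltac frob_lra :=
  repeat match goal with H : is_true _ |- _ => clear H end;
  repeat match goal with
  | |- context [frobnorm ?X] => move: (frobnorm X)
  | |- context [frob ?X ?Y] => move: (frob X Y)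
  end; intros; lra.

Section Algorithm.
Variables (R : realType) (m n r : nat) (f : 'M[R]_(m, n) -> R).
Hypothesis f_diff : forall X, differentiable f X.
Hypothesis gradf_lip : locally_lipschitz (grad f).
Variables amin amax beta c Delta : R.
Hypotheses (amin_gt0 : 0 < amin) (amin_le : amin <= amax).
Hypotheses (beta_gt0 : 0 < beta) (beta_lt1 : beta < 1).
Hypotheses (c_gt0 : 0 < c) (c_lt1 : c < 1) (Delta_gt0 : 0 < Delta).
Implicit Types (X Y Z V W G : 'M[R]_(m, n)).
Local Notation S := (@rank_le R m n r).
Local Notation tangent := (tangent_cone S).
Local Notation g := (grad f).

Lemma nonstationary_direction X : S X -> ~ B_stationary r f X ->
  exists2 V, tangent X V & 0 < frob V (- g X).
Proof.
move=> SX nX; apply: contrapT => noV; apply: nX; split=> // V TV.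
by rewrite leNgt; apply/negP => V0; apply: noV; exists V.
Qed.

Lemma grad_near X : \forall Y \near nbhs X, frobnorm (g Y) < frobnorm (g X) + 1.
Proof.
have /cvgr_lt : frobnorm (g Y) @[Y --> nbhs X] --> frobnorm (g X).
  by apply: cvg_frobnorm; exact: cvg_grad.
by apply; rewrite ltrDl.
Qed.

Lemma ball_near X (e : R) : 0 < e -> \forall Y \near nbhs X, frobnorm (Y - X) < e.
Proof. by move=> e0; apply/nbhs_frobP; exists e. Qed.

Lemma PGD_accept_near X : exists2 b : R, 0 < b & \forall Y \near nbhs X,
  S Y -> forall (a : R) Z, 0 < a -> a <= b -> proj S (Y - a *: g Y) Z ->
  f Z <= f Y + c * frob (g Y) (Z - Y).
Proof.
have [L L0 [e e0 D]] := descent_near f_diff gradf_lip X.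
set M := frobnorm (g X) + 1.
have M0 : 0 < M by rewrite ltr_wpDl ?frobnorm_ge0.
(* The first bound keeps |Z - Y| <= 2 a |g Y| within e/2. The second absorbs the quadratic term of
   the descent lemma, as projection gives |Z - Y|^2 <= -2 a <g Y, Z - Y>. *)
exists (Num.min (e / (4 * M)) ((1 - c) / (2 * L))).
  by rewrite lt_min !divr_gt0 ?mulr_gt0//; rewrite subr_gt0.
have e20 : 0 < e / 2 by lra.
apply: filterS2 (grad_near X) (ball_near X e20) => Y gM YX SY a Z a0.
rewrite le_min !ler_pdivlMr ?mulr_gt0// => /andP[aM aL] projZ.
have := proj_step SY projZ; have := proj_step_norm SY projZ.
rewrite frobNl frobZl frobnormN frobnormZ gtr0_norm//.
set q := frob (g Y) _; set N := frob (Z - Y) _ => ZY Nq.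
have ZX : frobnorm (Z - X) < e.
  have := frobnormB Z Y X.
  have : a * frobnorm (g Y) <= a * M by rewrite ler_wpM2l// ltW.
  by move: aM YX ZY; frob_lra.
have N0 : 0 <= N by exact: frob_ge0.
have q0 : 0 <= - q by rewrite -(pmulr_rge0 _ a0); move: N0 Nq; frob_lra.
have LN : L * N <= (a * (2 * L)) * - q.
  have -> : a * (2 * L) * - q = L * (2 * - (a * q)) by ring.
  by rewrite ler_pM2l.
have : a * (2 * L) * - q <= (1 - c) * - q by rewrite ler_wpM2r.
have Ye : frobnorm (Y - X) < e by move: YX e0; frob_lra.
by have := D Y Z Ye ZX; rewrite -/q -/N; move: LN; frob_lra.
Qed.

Lemma PGD_decrease_near X : S X -> ~ B_stationary r f X ->
  exists2 d : R, 0 < d & \forall Y \near nbhs X,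
  S Y -> forall Z, PGD r f amin amax beta c Y Z -> f Z <= f Y - d.
Proof.
move=> SX /(nonstationary_direction SX)[V [Xs [t [SXs Xs_X t0 Xs_V]]] gV].
have [b b0 accept] := PGD_accept_near X.
pose l := Num.min amin (beta * b).
have l0 : 0 < l by rewrite lt_min amin_gt0 mulr_gt0.
pose h Z' Y := frob (Z' - Y) (Z' - Y) / l + 2 * frob (g Y) (Z' - Y).
have [Z' SZ' hZ'] : exists2 Z', S Z' & h Z' X < 0.
  (* After division by [t i] the quadratic part of [h] vanishes in the limit, leaving 2 <g X, V> <
     0; a term of the tangent sequence then serves as [Z']. *)
  have : (t i)^-1 * h (Xs i) X @[i --> \oo] -->
      frob V (X - X) * l^-1 + 2 * frob (g X) V.
    have -> : (fun i => (t i)^-1 * h (Xs i) X) = fun i =>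
        frob ((t i)^-1 *: (Xs i - X)) (Xs i - X) * l^-1 +
        2 * frob (g X) ((t i)^-1 *: (Xs i - X)).
      by apply/funext => i; rewrite frobZl frobZr /h; ring.
    apply: cvgD; apply: cvgM; try exact: cvg_cst.
      by apply: cvg_frob => //; apply: cvgB => //; exact: cvg_cst.
    by apply: cvg_frob => //; exact: cvg_cst.
  rewrite subrr frob0r mul0r add0r => /cvgr_lt/(_ 0).
  have gV' : 2 * frob (g X) V < 0 by move: gV; rewrite frobC frobNl; frob_lra.
  move=> /(_ gV')[k _ /(_ k (leqnn k))]/= hk; exists (Xs k) => //.
  by rewrite -(pmulr_rlt0 _ (_ : 0 < (t k)^-1)) ?invr_gt0.
have ch : h Z' Y @[Y --> nbhs X] --> h Z' X.
  have cZ' : (fun Y => Z' - Y) @ nbhs X --> Z' - X.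
    by apply: cvgB => //; exact: cvg_cst.
  have c1 : frob (Z' - Y) (Z' - Y) @[Y --> nbhs X] --> frob (Z' - X) (Z' - X).
    exact: cvg_frob.
  have c2 : frob (g Y) (Z' - Y) @[Y --> nbhs X] --> frob (g X) (Z' - X).
    by apply: cvg_frob => //; exact: cvg_grad.
  exact: cvgD (cvgM c1 (cvg_cst _)) (cvgM (cvg_cst _) c2).
(* One factor 1/2 is lost in passing from [X] to a nearby [Y], the other comes from the 2 in front
   of the inner product in [h]. *)
exists (c * (- h Z' X / 4)); first by rewrite mulr_gt0// divr_gt0// oppr_gt0.
have hn : \forall Y \near nbhs X, h Z' Y < h Z' X / 2.
  by apply: (cvgr_lt _ ch); move: hZ'; move: (h Z' X) => x; frob_lra.
apply: filterS2 hn accept => Y hY acc SY Z [a [/andP[amin_a _] bt]].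
have [|a' [a'0 a'l projZ]] := backtracking_accept (b := b) beta_gt0 _
  (lt_le_trans amin_gt0 amin_a) bt.
  by move=> a' Y' a'0 a'b pY'; apply/negP; rewrite -leNgt; exact: acc pY'.
move/negP; rewrite -leNgt => fZ; apply: le_trans fZ _; rewrite lerD2l -mulrN.
rewrite ler_pM2l//.
have la' : l <= a'.
  by apply: le_trans a'l; rewrite /l le_min !ge_min amin_a lexx orbT.
have := proj_ineq projZ SZ'; rewrite !frobNl !frobZl.
have := frob_ge0 (Z - Y); set q := frob (g Y) _; set N := frob (Z - Y) _.
have N'l : frob (Z' - Y) (Z' - Y) <= a' * (frob (Z' - Y) (Z' - Y) / l).
  by rewrite mulrCA ler_peMr ?frob_ge0// ler_pdivlMr// mul1r.
move=> N0 ineq; rewrite -(ler_pM2l a'0); move: hY; rewrite -(ltr_pM2l a'0) {1}/h.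
rewrite mulrDr; move: (h Z' X) N'l N0 ineq => hX.
by move: (frob (Z' - Y) _ / l) => Nl; frob_lra.
Qed.

Lemma stat_measureE X G : proj (tangent X) (- g X) G ->
  stat_measure r f X = frobnorm G.
Proof.
move=> pG; have pex : exists G', proj (tangent X) (- g X) G' by exists G.
apply: proj_cone_norm (xgetPex 0 pex) pG.
by move=> a V; exact: tangent_coneZ.
Qed.

Lemma proj_tangent_frob X G : proj (tangent X) (- g X) G ->
  frob (g X) G = - frob G G.
Proof.
move=> /proj_cone_frob <-; last by move=> a V; exact: tangent_coneZ.
by rewrite frobNl opprK.
Qed.

(** [Z] is at least as close to Y + a G as the retracted point [Z'], so |Z - (Y + a G)| <= K a^2
    |G|^2. Hence the linear term of the descent lemma is -a |G|^2 up to M K a^2 |G|^2. *)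
Lemma P2GD_accept_near X : exists2 b : R, 0 < b & \forall Y \near nbhs X,
  S Y -> \rank Y = \rank X -> forall G (a : R) Z,
  proj (tangent Y) (- g Y) G -> 0 < a -> a <= b -> proj S (Y + a *: G) Z ->
  f Z <= f Y - c * a * stat_measure r f Y ^+ 2.
Proof.
have [L L0 [e e0 D]] := descent_near f_diff gradf_lip X.
have [K K0 retract] := tangent_retract_near r X.
set M := frobnorm (g X) + 1.
have M0 : 0 < M by rewrite ltr_wpDl ?frobnorm_ge0.
have MKL : 0 < M * K + 4 * L by rewrite addr_gt0 ?mulr_gt0.
(* The first bound keeps [Z] in the ball. The second makes the total error (M K + 4 L) a^2 |G|^2 at
   most (1 - c) a |G|^2; 4 L stems from |Z - Y| <= 2 a |G|. *)
exists (Num.min (e / (4 * M)) ((1 - c) / (M * K + 4 * L))).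
  by rewrite lt_min !divr_gt0 ?mulr_gt0// subr_gt0.
have e20 : 0 < e / 2 by lra.
apply: filterS3 (grad_near X) (ball_near X e20) retract.
move=> Y gM YX + SY rY G a Z pG a0.
move=> /(_ rY (a *: G) (tangent_coneZ a0 pG.1))[Z' SZ' Z'G].
rewrite le_min !ler_pdivlMr ?mulr_gt0// => /andP[aM aL] projZ.
rewrite (stat_measureE pG).
have gG := proj_tangent_frob pG.
have G0 := frobnorm_ge0 G.
(* Projection onto a cone does not increase the norm: |G|^2 = <-g Y, G> <= |g Y| |G|. *)
have GM : frobnorm G <= M.
  have := frobnorm_CS (- g Y) G; rewrite frobNl gG opprK frobnormN -frobnorm_sqr.
  have [->|Gn0] := eqVneq (frobnorm G) 0; first by move=> _; exact: ltW.
  by rewrite expr2 ler_pM2r ?lt_def ?Gn0// => h; apply: le_trans h (ltW gM).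
have := proj_step_norm SY projZ.
rewrite frobnormZ gtr0_norm// => ZY.
have ZX : frobnorm (Z - X) < e.
  have := frobnormB Z Y X.
  have : a * frobnorm G <= a * M by rewrite ler_wpM2l// ltW.
  by move: aM YX ZY; frob_lra.
have Ye : frobnorm (Y - X) < e by move: YX e0; frob_lra.
have := D Y Z Ye ZX.
have -> : frob (g Y) (Z - Y) = frob (g Y) (Z - (Y + a *: G)) - a * frobnorm G ^+ 2.
  have -> : Z - Y = Z - (Y + a *: G) + a *: G by rewrite opprD addrA subrK.
  by rewrite frobDr frobZr gG mulrN frobnorm_sqr.
have E1 : frob (g Y) (Z - (Y + a *: G)) <= M * (K * (a ^+ 2 * frobnorm G ^+ 2)).
  apply: le_trans (frobnorm_CS _ _) _.
  apply: ler_pM; rewrite ?frobnorm_ge0 ?(ltW gM)//.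
  rewrite -exprMn; move: Z'G; rewrite frobnormZ gtr0_norm//; apply: le_trans.
  by rewrite frobnormBC [leRHS]frobnormBC; exact: projZ.2.
have E2 : L * frob (Z - Y) (Z - Y) <= L * (4 * (a ^+ 2 * frobnorm G ^+ 2)).
  rewrite ler_pM2l// -frobnorm_sqr.
  have -> : 4 * (a ^+ 2 * frobnorm G ^+ 2) = (2 * (a * frobnorm G)) ^+ 2 by ring.
  by rewrite ler_sqr ?nnegrE ?mulr_ge0 ?frobnorm_ge0// ltW.
have E3 : a * (M * K + 4 * L) * (a * frobnorm G ^+ 2) <=
    (1 - c) * (a * frobnorm G ^+ 2).
  by rewrite ler_wpM2r// mulr_ge0 ?sqr_ge0// ltW.
have -> : c * a * frobnorm G ^+ 2 = c * (a * frobnorm G ^+ 2) by ring.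
have E4 : a * (M * K + 4 * L) * (a * frobnorm G ^+ 2) =
    M * (K * (a ^+ 2 * frobnorm G ^+ 2)) +
    L * (4 * (a ^+ 2 * frobnorm G ^+ 2)) by ring.
by move: E1 E2 E3; rewrite E4; frob_lra.
Qed.

Lemma P2GD_decrease_near X : S X -> ~ B_stationary r f X ->
  exists2 d : R, 0 < d & \forall Y \near nbhs X,
  S Y -> \rank Y = \rank X ->
  forall Z, P2GD r f amin amax beta c Y Z -> f Z <= f Y - d.
Proof.
move=> SX /(nonstationary_direction SX)[V TV gV].
have [b b0 accept] := P2GD_accept_near X.
have [VY cV TVY] := tangent_near TV.
set k := frob V _ in gV.
pose l := Num.min amin (beta * b).
have l0 : 0 < l by rewrite lt_min amin_gt0 mulr_gt0.
have N0 : 0 <= frob V V by exact: frob_ge0.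
have N1 : 0 < frob V V + 1 by rewrite ltr_wpDl.
(* Comparing [G] with t times the transported vector bounds |G|^2 below by a quantity tending to 2 t
   k - t^2 |V|^2. This [t] makes the limit at least t k, so t k / 2 remains a bound near [X]. *)
pose t := k / (frob V V + 1); have t0 : 0 < t by rewrite divr_gt0.
have c1 : frob (VY Y) (- g Y) @[Y --> nbhs X] --> k.
  by apply: cvg_frob => //; apply: cvgN; exact: cvg_grad.
have c2 : frob (VY Y) (VY Y) @[Y --> nbhs X] --> frob V V by exact: cvg_frob.
have ch : 2 * t * frob (VY Y) (- g Y) - t ^+ 2 * frob (VY Y) (VY Y)
    @[Y --> nbhs X] --> 2 * t * k - t ^+ 2 * frob V V.
  exact: cvgB (cvgM (cvg_cst _) c1) (cvgM (cvg_cst _) c2).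
have lim_gt : t * k / 2 < 2 * t * k - t ^+ 2 * frob V V.
  have tk : t ^+ 2 * (frob V V + 1) = t * k.
    by rewrite expr2 -mulrA {2}/t divfK// gt_eqF.
  have := sqr_ge0 t; have := mulr_gt0 t0 gV; move: tk.
  by rewrite mulrDr mulr1 -(mulrA 2); move: (t * k) (t ^+ 2) => x y; frob_lra.
exists (c * l * (t * k / 2)).
  by rewrite !mulr_gt0 ?invr_gt0.
apply: filterS3 (filterI accept TVY) (cvgr_gt _ ch _ lim_gt) (mxrank_near X).
move=> Y [acc {}TVY] hY _ SY rY Z [G [a [pG /andP[amin_a _] bt]]].
have [|a' [a'0 a'l projZ]] := backtracking_accept (b := b) beta_gt0 _
  (lt_le_trans amin_gt0 amin_a) bt.
  by move=> a' Y' a'0 a'b pY'; apply/negP; rewrite -leNgt; exact: acc pY'.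
move/negP; rewrite -leNgt => fZ; apply: le_trans fZ _; rewrite lerD2l lerN2.
rewrite -(mulrA c l) -(mulrA c a') ler_pM2l//.
have la' : l <= a'.
  by apply: le_trans a'l; rewrite /l le_min !ge_min amin_a lexx orbT.
apply: ler_pM => //; rewrite ?ltW// ?mulr_gt0// ?invr_gt0//.
rewrite (stat_measureE pG) frobnorm_sqr.
have := pG.2 _ (tangent_coneZ t0 (TVY rY)).
rewrite ler_sqrt ?frob_ge0// !frob_subsqr !frobZl !frobZr !frobNl.
rewrite (proj_tangent_frob pG) opprK.
move: hY; rewrite frobNr (frobC (VY Y) (g Y)).
by move: (t * k / 2) => x; frob_lra.
Qed.

Lemma decrease_near X : S X -> ~ B_stationary r f X ->
  exists2 d : R, 0 < d & \forall Y \near nbhs X,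
  S Y -> forall Z, P2GD_PGD r f amin amax beta c Delta Y Z -> f Z <= f Y - d.
Proof.
move=> SX nX; have [d1 d10 D1] := PGD_decrease_near SX nX.
have [d2 d20 D2] := P2GD_decrease_near SX nX.
exists (Num.min d1 d2); first by rewrite lt_min d10.
apply: filterS3 (filterI D1 D2) (mxrank_near X) (ball_near X Delta_gt0).
move=> Y [{}D1 {}D2] XY YX SY Z; rewrite /P2GD_PGD; case: eqP => [rY|_] out.
  (* In the P2GD branch rank Y is [rank_Delta Delta Y], at most rank X within distance [Delta];
     semicontinuity gives the converse inequality. *)
  have rYX : \rank Y = \rank X.
    by apply/eqP; rewrite eqn_leq XY andbT rY rank_Delta_le.
  by apply: le_trans (D2 SY rYX _ out) _; rewrite lerD2l lerN2 ge_min lexx orbT.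
by apply: le_trans (D1 SY _ out) _; rewrite lerD2l lerN2 ge_min lexx.
Qed.

(** Projections onto the variety and its tangent cones exist because these sets are closed and
    nonempty. The local acceptance bound, read at [X] itself, makes backtracking from [amin]
    terminate. *)
Lemma P2GD_PGD_nonempty X : S X ->
  exists Y, P2GD_PGD r f amin amax beta c Delta X Y.
Proof.
move=> SX; have amin_aa : amin <= amin <= amax by rewrite lexx.
have projS Z : exists Y, proj S Z Y.
  apply: proj_nonempty; first exact: closed_rank_le.
  by exists 0; rewrite /rank_le/= mxrank0.
rewrite /P2GD_PGD; case: ifP => _.
  have [G pG] : exists G, proj (tangent X) (- g X) G.
    apply: proj_nonempty; first exact: closed_tangent.
    by exists 0; exact: tangent0.
  have [b b0 /nbhs_singleton acc] := P2GD_accept_near X.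
  have [|a' Y' a'0 a'b pY'|Y bt] := backtracking_ex (a := amin) (b := b)
      (cand := fun a' => proj S (X + a' *: G))
      (reject := fun a' Y' => f Y' > f X - c * a' * stat_measure r f X ^+ 2)
      beta_gt0 beta_lt1 b0 _ _ amin_gt0.
  - by move=> a' _; exact: projS.
  - by apply/negP; rewrite -leNgt; exact: acc pY'.
  - by exists Y, G, amin.
have [b b0 /nbhs_singleton acc] := PGD_accept_near X.
have [|a' Y' a'0 a'b pY'|Y bt] := backtracking_ex (a := amin) (b := b)
    (cand := fun a' => proj S (X - a' *: g X))
    (reject := fun _ Y' => f Y' > f X + c * frob (g X) (Y' - X))
    beta_gt0 beta_lt1 b0 _ _ amin_gt0.
- by move=> a' _; exact: projS.
- by apply/negP; rewrite -leNgt; exact: acc pY'.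
- by exists Y, amin.
Qed.

Lemma P2GD_PGD_le X Y : S X -> P2GD_PGD r f amin amax beta c Delta X Y ->
  S Y /\ f Y <= f X.
Proof.
move=> SX; rewrite /P2GD_PGD; case: ifP => _.
  move=> [G [a [_ /andP[amin_a _] bt]]].
  (* With [b := 0] the acceptance hypothesis is vacuous: only the test passed by the returned point
     is extracted. *)
  have [|a' [a'0 _ [SY _]]] := backtracking_accept (b := 0) beta_gt0 _
    (lt_le_trans amin_gt0 amin_a) bt.
    by move=> a' Y' /lt_le_trans h /h; rewrite ltxx.
  move/negP; rewrite -leNgt => fY; split=> //; apply: le_trans fY _.
  by rewrite gerBl; apply: mulr_ge0; [rewrite ltW// mulr_gt0|exact: sqr_ge0].
move=> [a [/andP[amin_a _] bt]].
have [|a' [a'0 _ pY]] := backtracking_accept (b := 0) beta_gt0 _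
  (lt_le_trans amin_gt0 amin_a) bt.
  by move=> a' Y' /lt_le_trans h /h; rewrite ltxx.
move/negP; rewrite -leNgt => fY; split; first exact: pY.1.
apply: le_trans fY _; rewrite gerDl pmulr_rle0//.
have := proj_step SX pY; rewrite frobNl frobZl => h.
rewrite -(pmulr_rle0 _ a'0); have := frob_ge0 (Y - X); move: h; frob_lra.
Qed.

End Algorithm.

(** * B-stationarity of last elements and of accumulation points *)

Theorem theorem7p3 (R : realType) (m n r : nat)
    (m_gt0 : (0 < m)%N) (n_gt0 : (0 < n)%N) (r_gt0 : (0 < r)%N)
    (r_lt : (r < minn m n)%N)
    (f : 'M[R]_(m, n) -> R)
    (f_diff : forall X, differentiable f X)
    (gradf_lip : locally_lipschitz (grad f))
    (amin amax beta c Delta : R)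
    (amin_gt0 : 0 < amin) (amin_le : amin <= amax)
    (beta_gt0 : 0 < beta) (beta_lt1 : beta < 1)
    (c_gt0 : 0 < c) (c_lt1 : c < 1)
    (Delta_gt0 : 0 < Delta)
    (Xs : nat -> 'M[R]_(m, n)) :
  (forall N : nat, generated_finite r f amin amax beta c Delta Xs N ->
    B_stationary r f (Xs N)) /\
  (generated_infinite r f amin amax beta c Delta Xs ->
    forall X : 'M[R]_(m, n), cluster (Xs i @[i --> \oo]) X ->
      B_stationary r f X).
Proof.
split=> [N [X0r steps]|[X0r steps] X clX].
  have SXs i : (i <= N)%N -> rank_le r (Xs i).
    elim: i => [//|i IHi] iN; have [_ out] := steps _ iN.
    by have [] := P2GD_PGD_le amin_gt0 beta_gt0 c_gt0 (IHi (ltnW iN)) out.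
  case=> // empty.
  have [Y] : exists Y, P2GD_PGD r f amin amax beta c Delta (Xs N) Y.
    by apply: P2GD_PGD_nonempty => //; exact: SXs.
  by rewrite empty.
have SXs i : rank_le r (Xs i).
  elim: i => [//|i IHi]; have [_ out] := steps i.
  by have [] := P2GD_PGD_le amin_gt0 beta_gt0 c_gt0 IHi out.
have fmono i j : (i <= j)%N -> f (Xs j) <= f (Xs i).
  elim: j => [|j IHj]; first by rewrite leqn0 => /eqP->.
  rewrite leq_eqVlt => /orP[/eqP->//|ij]; apply: le_trans (IHj ij).
  have [_ out] := steps j.
  by have [] := P2GD_PGD_le amin_gt0 beta_gt0 c_gt0 (SXs j) out.
have visit k U : nbhs X U -> exists2 i, (k <= i)%N & U (Xs i).
  move=> XU; have tail : (Xs i @[i --> \oo]) [set Xs i | i in [set i | (k <= i)%N]].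
    by exists k => // i ki; exists i.
  by have [_ [[i ki <-] Ui]] := clX _ _ tail XU; exists i.
have SX : rank_le r X.
  by have [i _] := visit 0%N _ (mxrank_near X); move/leq_trans; apply; exact: SXs.
apply: contrapT => nX.
have [d d0 dec] : exists2 d : R, 0 < d & \forall Y \near nbhs X, rank_le r Y ->
    forall Z, P2GD_PGD r f amin amax beta c Delta Y Z -> f Z <= f Y - d.
  exact: decrease_near.
have cf : f @ nbhs X --> f X by exact: differentiable_continuous.
have d20 : 0 < d / 2 by rewrite divr_gt0.
have fX : \forall Y \near nbhs X, `|f X - f Y| < d / 2.
  by move/cvgrPdist_lt : cf; apply.
have FX : Filter (nbhs X) by apply: filter_filter.
have near_X := @filterI _ _ FX _ _ dec fX.
(* Two visits i < j near [X] conflict: monotonicity and the local decrease give f (Xs j) <= f (Xs i)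
   - d, while both values lie strictly within d/2 of f X. *)
have [i _ [{}dec fi]] := visit 0%N _ near_X.
have [j ij [_ fj]] := visit i.+1 _ near_X.
have := dec (SXs i) _ (steps i).2; have := fmono _ _ ij.
move: fi fj; rewrite !ltr_norml => /andP[fi _] /andP[_ fj].
by move: fi fj; frob_lra.
Qed.
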